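(* Let $\mathcal D=(d_1,\ldots,d_n)$ be a positive non-decreasing degree sequence and let $D_{\mathcal D}=|\{d_i : 1\le i\le n\}|$ be the number of distinct degrees in it. If the group list $L$ is stored in an external-memory list, then the optimized variant of the algorithm EM-HH (described in the context) run on $\mathcal D$ requires $O(\mathrm{scan}(D_{\mathcal D}))$ I/Os.
   Context: External memory model (Aggarwal–Vitter): there is an internal memory holding up to $M$ items and a disk of unbounded size; computation is only possible on items in internal memory; one I/O transfers a block of $B$ consecutive items between disk and internal memory. $\mathrm{scan}(k)=\Theta(k/B)$ is the number of I/Os for reading or writing $k$ contiguous items. An external-memory list is a linked list on disk that executes any sequence of $k$ sequential read, insertion and deletion requests to adjacent positions (i.e. without seeking) in $O(\mathrm{scan}(k))$ I/Os. A constant number of blocks of the list may be kept cached in internal memory. Only the I/Os for accessing the list $L$ are counted: the edges produced are emitted as a stream and the cost of storing this output is not counted. Task: EM-HH is a variant of the Havel–Hakimi algorithm. It takes a positive non-decreasing sequence $\mathcal D=(d_1,\ldots,d_n)$ for nodes $v_1,\ldots,v_n$ and emits the edges of a simple graph realizing it (if $\mathcal D$ is graphical; unsatisfiable requests are ignored). Data structure: a doubly linked list $L=[g_j]_{1\le j\le |L|}$ of groups $g_j=(b_j,n_j,\delta_j)$, where $g_j$ says that the $n_j$ nodes $v_{b_j},\ldots,v_{b_j+n_j-1}$ currently have remaining degree $\delta_j$. Initially there is one group per distinct degree of $\mathcal D$, so $|L|=D_{\mathcal D}$. At the beginning of every iteration these invariants hold: (I1) $\delta_j<\delta_{j+1}$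 for all $1\le j<|L|$; (I2) $b_j+n_j=b_{j+1}$ for all $1\le j<|L|$. Algorithm: EM-HH works in $n$ rounds. Each round extracts the node $u=v_{b_1}$ (smallest id, minimal remaining degree $\delta_1$) by setting $b_1\gets b_1+1$, $n_1\gets n_1-1$; if $g_1$ becomes empty it is removed from $L$ at the end of the round. Then $u$ is connected to $\delta_1$ nodes from the end of $L$. Let $g_j$ be the group of smallest index to which $u$ connects. (C1) If $u$ connects to all nodes of $g_j$, the edges from $u$ to the last $\delta_1$ nodes are emitted and the degrees of $g_j,\ldots,g_{|L|}$ are decremented by one. If then $\delta_{j-1}=\delta_j$, the two groups are merged ($n_{j-1}\gets n_{j-1}+n_j$, delete $g_j$). (C2) If $u$ connects only to $a<n_j$ nodes of $g_j$, then $g_j$ is split into adjacent groups $g_j'$ (the first $a$ nodes) and $g_j''$ (the remaining $n_j-a$ nodes). Node $u$ is connected to all nodes of $g_j'$, whose degree is decremented by one, and to all nodes of $g_{j+1},\ldots,g_{|L|}$, whose degrees are decremented by one as in (C1). Adjacent groups of equal degree that arise are merged as in (C1), restoring (I1). Optimized variant: only groups in the vicinity of $g_j$ (the active frontier) can be split or merged. The groups $g_{j+1},\ldots,g_{|L|}$ are called stable; their degrees are not explicitly decremented in every round. Instead a global iteration counter $I$ is maintained. When a group $g_k$ becomes stable in iteration $I_0$, its stored value is set to $\delta_k\gets\delta_k+I_0$; when it has to be activated again (as a merge candidate) in iteration $I>I_0$, its actual degree is recovered by $\delta_k\gets\delta_k-I$. *)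

(* Defs.v *)
From mathcomp Require Import all_boot.

Set Implicit Arguments.
Unset Strict Implicit.
Unset Printing Implicit Defensive.

(* scan(k) = Theta(k/B) is taken to be the ceiling of k/B. *)
Definition scan (B k : nat) : nat := (k + B.-1) %/ B.

(** * External-memory lists *)

(* Positions are 0-based.  [Insert p x] puts [x] just before position [p]. *)
Inductive request (T : Type) : Type :=
  | Read of nat
  | Insert of nat & T
  | Delete of nat.
Arguments Read {T} _.
Arguments Delete {T} _.

Section Requests.
Variable T : Type.
Implicit Types (r : request T) (l : seq T).

Definition position r : nat :=
  match r with Read p => p | Insert p _ => p | Delete p => p end.

Definition valid_request l r : bool :=
  match r with
  | Read p => p < size l
  | Insert p _ => p <= size l
  | Delete p => p < size l
  end.

Definition apply_request l r : seq T :=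
  match r with
  | Read _ => l
  | Insert p x => take p l ++ x :: drop p l
  | Delete p => take p l ++ drop p.+1 l
  end.

Fixpoint valid_requests l (rs : seq (request T)) : bool :=
  if rs is r :: rs' then
    valid_request l r && valid_requests (apply_request l r) rs'
  else true.

(* No seeking: each request is at most one position away from the previous. *)
Definition adjacent (r r' : request T) : bool :=
  (position r <= (position r').+1) && (position r' <= (position r).+1).

Definition sequential (rs : seq (request T)) : bool := sorted adjacent rs.

Section Execution.
Variables (S : Type) (exec : S -> request T -> S) (cost : S -> request T -> nat).

Fixpoint total_cost (s : S) (rs : seq (request T)) : nat :=
  if rs is r :: rs' then cost s r + total_cost (exec s r) rs' else 0.

End Execution.
End Requests.

(* An arbitrary list data structure on disk, with block size [B], in which
   every sequence of k valid requests without seeking costs at most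
   [c * scan B k] I/Os, whatever the state in which it is started. *)
Record emlist (T : Type) (c B : nat) := EMList {
  em_state : Type;
  em_empty : em_state;
  em_items : em_state -> seq T;
  em_exec : em_state -> request T -> em_state;
  em_cost : em_state -> request T -> nat;
  em_items_empty : em_items em_empty = [::];
  em_items_exec : forall s r, valid_request (em_items s) r ->
    em_items (em_exec s r) = apply_request (em_items s) r;
  em_scan : forall s rs, valid_requests (em_items s) rs -> sequential rs ->
    total_cost em_exec em_cost s rs <= c * scan B (size rs)
}.

(** * The optimized variant of EM-HH *)

(* [Group b n delta]: nodes v_b, ..., v_(b+n-1) have remaining degree delta.
   Nodes are numbered from 1. *)
Record group := Group { gid : nat; gsize : nat; gdeg : nat }.

Definition initial_groups (D : seq nat) : seq group :=
  [seq Group (index x D).+1 (count_mem x D) x | x <- undup D].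

Definition stabilize (it : nat) (g : group) : group :=
  Group (gid g) (gsize g) (gdeg g + it).

Definition activate (it : nat) (g : group) : group :=
  Group (gid g) (gsize g) (gdeg g - it).

(* A round runs through these phases.  [u] is the extracted node and [d] the
   number of nodes it connects to. *)
Inductive phase : Type :=
  | Extract
  | Seek of nat & nat
  | Connect of nat & nat
  | Cleanup.

(* A cell of L is [Some g] if the group [g] is in internal memory, and [None]
   if it is on disk only.  The first [cursor] cells are the active groups,
   carrying their actual degrees; the other cells are the stable groups,
   carrying [degree + iteration at which they became stable].
   [edges] is the output stream. *)
Record hh_state := HHState {
  cells : seq (option group);
  cursor : nat;
  counter : nat;
  stage : phase;
  edges : seq (nat * nat)
}.

Definition cell (L : seq (option group)) (i : nat) : option group :=
  nth None L i.

(* Replace the cells at positions i, ..., j-1. *)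
Definition splice (L : seq (option group)) (i j : nat) (gs : seq group) :=
  take i L ++ map Some gs ++ drop j L.

(* The groups replacing two neighbours [p], [g]. *)
Definition merge (p g : group) : seq group :=
  if gdeg p == gdeg g then [:: Group (gid p) (gsize p + gsize g) (gdeg p)]
  else [:: p; g].

(* Every step below returns [None] when it needs a group that is not in
   internal memory. *)

(* Requests exceeding the number of remaining nodes are cut off.  The first
   group is itself stable when the cursor is 0; it is then activated. *)
Definition extract_step (n : nat) (s : hh_state) : option hh_state :=
  let: HHState L cur it _ out := s in
  if cell L 0 is Some h then
    let g := if cur == 0 then activate it h else h in
    let u := gid g in
    let d := minn (gdeg g) (n - u) in
    Some (HHState (splice L 0 1 [:: Group u.+1 (gsize g).-1 (gdeg g)])
            (maxn cur 1) it (if d == 0 then Cleanup else Seek u d) out)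
  else None.

(* Move the cursor, one group at a time, until the last active group is the
   group g_j containing the first node [n.+1 - d] of the last [d] nodes. *)
Definition seek_step (n u d : nat) (s : hh_state) : option hh_state :=
  let: HHState L cur it _ out := s in
  let f := n.+1 - d in
  if cell L cur.-1 is Some g then
    if f < gid g then
      Some (HHState (splice L cur.-1 cur [:: stabilize it g]) cur.-1 it
              (Seek u d) out)
    else if gid g + gsize g <= f then
      if cell L cur is Some q then
        Some (HHState (splice L cur cur.+1 [:: activate it q]) cur.+1 it
                (Seek u d) out)
      else None
    else Some (HHState L cur it (Connect u d) out)
  else None.

(* [g], the last active group, is g_j.  The decrement of the stable groups is
   implicit in the increment of the counter at the end of the round; hence
   the degree of a stable group [q] after round [it] is
   [gdeg (activate it q) - 1]. *)
Definition connect_step (n u d : nat) (s : hh_state) : option hh_state :=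
  let: HHState L cur it _ out := s in
  let f := n.+1 - d in
  if cell L cur.-1 is Some g then
    let last := gid g + gsize g in
    let a := last - f in
    let join_left (g' : group) : option (seq group) :=
      if cur == 1 then Some [:: g']
      else if cell L cur.-2 is Some p then Some (merge p g') else None in
    if f == gid g then
      if join_left (Group (gid g) (gsize g) (gdeg g).-1) is Some gs then
        Some (HHState (splice L cur.-2 cur gs) (cur.-2 + size gs) it Cleanup
                (out ++ [seq (u, v) | v <- iota f d]))
      else None
    else
      let g1 := Group (gid g) a (gdeg g).-1 in
      let g2 := Group (gid g + a) (gsize g - a) (gdeg g) in
      let out' := out ++ [seq (u, v) | v <- iota (gid g) a]
                      ++ [seq (u, v) | v <- iota last (n.+1 - last)] in
      if join_left g1 is Some gs then
        if cur < size L then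
          if cell L cur is Some q then
            if (gdeg (activate it q)).-1 == gdeg g2 then
              let g3 := Group (gid g2) (gsize g2 + gsize q) (gdeg g2) in
              Some (HHState (splice L cur.-2 cur.+1 (rcons gs g3))
                      (cur.-2 + (size gs).+1) it Cleanup out')
            else
              Some (HHState (splice L cur.-2 cur (rcons gs g2))
                      (cur.-2 + (size gs).+1) it Cleanup out')
          else None
        else
          Some (HHState (splice L cur.-2 cur (rcons gs g2))
                  (cur.-2 + (size gs).+1) it Cleanup out')
      else None
  else None.

Definition cleanup_step (s : hh_state) : option hh_state :=
  let: HHState L cur it _ out := s in
  if cell L 0 is Some h then
    if gsize h == 0 then
      Some (HHState (behead L) cur.-1 it.+1 Extract out)
    else Some (HHState L cur it.+1 Extract out)
  else None.

Definition hh_step (n : nat) (s : hh_state) : option hh_state :=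
  match stage s with
  | Extract => extract_step n s
  | Seek u d => seek_step n u d s
  | Connect u d => connect_step n u d s
  | Cleanup => cleanup_step s
  end.

(** * Running EM-HH on an external-memory list *)

Definition cached (L : seq (option group)) : nat := count isSome L.

(* A caching policy decides, before each step, which cells are to be kept in
   internal memory for it.  It sees only the cells in internal memory and the
   cursor, so it cannot depend on what is on disk or on later rounds. *)
Definition policy := seq (option group) -> nat -> seq bool.

(* The groups in internal memory are checked out of the external list, which
   stores exactly the [None] cells, in order.  Changing the residency of the
   cells of [L] to the one prescribed by [keep] needs the following requests,
   in one pass; [p] is the current position in the external list. *)
Fixpoint transfer_requests (L : seq (option group)) (keep : seq bool) (p : nat)
    : seq (request group) :=
  match L with
  | [::] => [::]
  | None :: L' =>
      if head false keep then
        Read p :: Delete p :: transfer_requests L' (behead keep) p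
      else transfer_requests L' (behead keep) p.+1
  | Some g :: L' =>
      if head false keep then transfer_requests L' (behead keep) p
      else Insert p g :: transfer_requests L' (behead keep) p.+1
  end.

(* [disk] holds the contents of the external list before the transfer. *)
Fixpoint transfer_cells (L : seq (option group)) (keep : seq bool)
    (disk : seq group) : seq (option group) :=
  match L with
  | [::] => [::]
  | None :: L' =>
      (if head false keep then ohead disk else None)
        :: transfer_cells L' (behead keep) (behead disk)
  | Some g :: L' =>
      (if head false keep then Some g else None)
        :: transfer_cells L' (behead keep) disk
  end.

Section Machine.
Variables (c B : nat) (E : emlist group c B).

Record machine := Machine {
  algo : hh_state;
  store : em_state E;
  ios : nat
}.

Definition execute (s : em_state E) (rs : seq (request group)) : em_state E :=
  foldl (@em_exec _ _ _ E) s rs.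

Definition cost (s : em_state E) (rs : seq (request group)) : nat :=
  total_cost (@em_exec _ _ _ E) (@em_cost _ _ _ E) s rs.

(* At first L is written to the external list; no group is in internal
   memory, and no group is stable. *)
Definition initial_machine (D : seq nat) : machine :=
  let gs := initial_groups D in
  let rs := [seq Insert p.1 p.2 | p <- zip (iota 0 (size gs)) gs] in
  Machine (HHState (nseq (size gs) None) (size gs) 0 Extract [::])
    (execute (em_empty E) rs) (cost (em_empty E) rs).

(* One transfer followed by one step of EM-HH on [n] nodes.  At most K blocks
   may be kept in internal memory, whose capacity is M groups.  The groups
   held before and after the transfer are counted together, so that loading
   and evicting may be done in any order. *)
Definition machine_step (K M : nat) (pol : policy) (n : nat) (m : machine)
    : option machine :=
  let: Machine (HHState L cur it ph out) s i := m in
  let keep := pol L cur in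
  let rs := transfer_requests L keep 0 in
  let L' := transfer_cells L keep (em_items s) in
  if (cached L + cached L' <= K * B) && (cached L + cached L' <= M) then
    if hh_step n (HHState L' cur it ph out) is Some h then
      Some (Machine h (execute s rs) (i + cost s rs))
    else None
  else None.

Definition run (K M : nat) (pol : policy) (D : seq nat) (t : nat)
    : option machine :=
  iter t (obind (machine_step K M pol (size D))) (Some (initial_machine D)).

Definition terminated (m : machine) : bool := nilp (cells (algo m)).

End Machine.

(* Main.v *)
From mathcomp Require Import all_boot zify.
Require Import Defs.

Set Implicit Arguments.
Unset Strict Implicit.
Unset Printing Implicit Defensive.

(* When [u] is extracted with [d] requests, put [f = n + 1 - d].  The boundaries
   between groups carry chips, namely the jumps of the degree.  A round removes
   one chip from each of the two boundaries around [f] and puts one chip strictly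
   between them (or, if [f] is itself a boundary, removes one chip there).  So at
   any time the boundaries consist of [k] boundaries left of [f], then at most one
   fresh boundary with a single chip, then boundaries right of [f]: the fresh
   boundary is consumed by the next round unless [f] jumps over an older boundary
   to the left.  Since the minimal degree can only drop in a round in which no
   boundary is left of [f], the number [k] never increases, the cursor stays
   within a constant of [k] except while it seeks to the left, and
   [|L| + k - (1 if there is a fresh boundary)] never increases either.

   The policy keeps the head of L and a window of O(B) cells around the cursor,
   and reloads both only when a needed cell is missing.  Between two reloads the
   sum of the two potentials drops by at least B, and it starts at O(D). *)

(** * Contiguous group lists and the frontier *)

(* A state [(z, b, lo)] holds lower bounds [z] and [lo] for the size and the degree
   of the next group, and its first node [b]; only the first group may be empty. *)
Fixpoint seg (s : nat * nat * nat) (H : seq group) (t : nat * nat * nat) : Prop :=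
  if H is g :: T then
    [/\ s.1.1 <= gsize g, gid g = s.1.2, s.2 <= gdeg g
      & seg (1, s.1.2 + gsize g, (gdeg g).+1) T t]
  else s = t.

Fixpoint chain (s : nat * nat * nat) (H : seq group) (e : nat) : Prop :=
  if H is g :: T then
    [/\ s.1.1 <= gsize g, gid g = s.1.2, s.2 <= gdeg g
      & chain (1, s.1.2 + gsize g, (gdeg g).+1) T e]
  else s.1.2 = e.

Lemma seg_cat s X Y t :
  seg s (X ++ Y) t <-> exists2 m, seg s X m & seg m Y t.
Proof.
elim: X s => [|g X IH] s /=; first by split=> [|[m ->]] //; exists s.
split=> [[h1 h2 h3 /IH[m h4 h5]]|[m [h1 h2 h3 h4] h5]]; first by exists m.
by split=> //; apply/IH; exists m.
Qed.

Lemma chain_cat s X Y e :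
  chain s (X ++ Y) e <-> exists2 m, seg s X m & chain m Y e.
Proof.
elim: X s => [|g X IH] s /=; first by split=> [|[m ->]] //; exists s.
split=> [[h1 h2 h3 /IH[m h4 h5]]|[m [h1 h2 h3 h4] h5]]; first by exists m.
by split=> //; apply/IH; exists m.
Qed.

Lemma seg_mono s X t : seg s X t -> s.1.2 <= t.1.2 /\ s.2 <= t.2.
Proof.
elim: X s => [|g X IH] s /=; first by move=> ->.
by case=> h1 h2 h3 /IH /=; lia.
Qed.

Lemma seg_pos s X t : seg s X t -> 0 < s.1.1 -> 0 < t.1.1.
Proof. by elim: X s => [|g X IH] s /=; [move-> | case=> _ _ _ /IH /= h _; apply: h]. Qed.

Lemma chain_gid s H e : chain s H e -> all (fun g => s.1.2 <= gid g) H.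
Proof.
elim: H s => [|g H IH] s //= [h1 h2 h3 /IH h4]; rewrite h2 leqnn /=.
by apply: sub_all h4 => h /=; lia.
Qed.

Lemma chain_end s H e : chain s H e -> s.1.2 <= e.
Proof. by elim: H s => [|g H IH] s /=; [move-> | case=> h1 h2 h3 /IH /=; lia]. Qed.

Lemma chain_size s H e : chain s H e -> 0 < s.1.1 -> s.1.2 + size H <= e.
Proof.
elim: H s => [|g H IH] s /=; first lia.
by case=> h1 h2 h3 /IH /=; lia.
Qed.

Lemma chain_weak z b lo z' lo' H e : z' <= z -> lo' <= lo ->
  chain (z, b, lo) H e -> chain (z', b, lo') H e.
Proof. by case: H => [|g H] //= hz hl [h1 h2 h3 h4]; split=> //; lia. Qed.

Definition dec := activate 1.

(** Truncated subtraction is harmless here: a positive lower bound keeps every degree positive, so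
    all gaps survive the decrement. *)
Lemma chain_dec s H e : 0 < s.2 -> chain s H e ->
  chain (s.1, s.2.-1) (map dec H) e.
Proof.
elim: H s => [|g H IH] s //= h0 [h1 h2 h3 /IH h4]; split=> //=; first lia.
have -> : (gdeg g - 1).+1 = (gdeg g).+1.-1 by lia.
exact: h4.
Qed.

Lemma activateS it g : activate it.+1 g = dec (activate it g).
Proof. by rewrite /dec /activate /= -subnDA addn1. Qed.

Lemma stabilizeK it g : activate it (stabilize it g) = g.
Proof. by case: g => b m d; rewrite /activate /stabilize /= addnK. Qed.

(** The list with its delayed decrements carried out. The degree invariants speak about these true
    degrees, the machine about the stored ones. *)
Definition actual it cur (G : seq group) := take cur G ++ map (activate it) (drop cur G).

Lemma actual_cat it X Y : actual it (size X) (X ++ Y) = X ++ map (activate it) Y.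
Proof. by rewrite /actual take_size_cat // drop_size_cat. Qed.

Lemma map_activateS it Y : map (activate it.+1) Y = map dec (map (activate it) Y).
Proof. by rewrite -map_comp; apply: eq_map => g; rewrite /= activateS. Qed.

Lemma all_gid_map (P : pred nat) it Y :
  all (fun g => P (gid g)) (map (activate it) Y) = all (fun g => P (gid g)) Y.
Proof. by rewrite all_map; apply: eq_all. Qed.

(* [frontier f k fl H]: [k] old boundaries lie left of [f]; [fl] tells whether they
   are followed by a fresh boundary, on either side of [f] and with degree gap 1. *)
Variant frontier (f : nat) : nat -> bool -> seq group -> Prop :=
  | Plain A g Z of A = [::] \/ gid g < f & all (fun z => f <= gid z) Z :
      frontier f (size A) false (A ++ g :: Z)
  | Fresh A g p Z of A = [::] \/ gid g < f & gdeg p = (gdeg g).+1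
        & all (fun z => f <= gid z) Z :
      frontier f (size A) true (A ++ g :: p :: Z).

(** Groups starting at or beyond [f] are moved one by one to the right part; each move only lowers
    the count of old boundaries. *)
Lemma frontier_plain f A g Z : all (fun z => f <= gid z) Z ->
  exists2 k, k <= size A & frontier f k false (A ++ g :: Z).
Proof.
elim/last_ind: A g Z => [|A a IH] g Z hZ.
  by exists 0 => //; apply: (@Plain f [::]) => //; left.
have [hg|hg] := ltnP (gid g) f.
  by exists (size (rcons A a)) => //; apply: Plain => //; right.
rewrite cat_rcons; have [|k hk hf] := IH a (g :: Z); first by rewrite /= hg.
by exists k => //; rewrite size_rcons; lia.
Qed.

(** Lowering the threshold turns old boundaries into right ones. The fresh flag is lost only when
    [f'] also passes the group before the fresh boundary; then an old boundary is lost as well,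
    which pays for the flag. *)
Lemma frontier_le f f' k fl H s e : f' <= f -> frontier f k fl H -> chain s H e ->
  exists k' fl', [/\ frontier f' k' fl' H, k' <= k & k' + ~~ fl' <= k + ~~ fl].
Proof.
move=> hf; case=> [A g Z hA hZ|A g p Z hA hp hZ] hc.
  have hZ': all (fun z => f' <= gid z) Z by apply: sub_all hZ => z /=; lia.
  by have [j hk hk2] := @frontier_plain f' A g Z hZ'; exists j, false; split=> //; lia.
have hZ': all (fun z => f' <= gid z) Z by apply: sub_all hZ => z /=; lia.
case: (ltnP (gid g) f') => hg.
  by exists (size A), true; split=> //; apply: Fresh => //; right.
case: (lastP A) hA hc => [|A0 a] hA hc.
  by exists 0, true; split=> //; apply: (@Fresh f' [::]) => //; left.
rewrite cat_rcons.
have hpz : all (fun z => f' <= gid z) (g :: p :: Z).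
  rewrite /= hg hZ' andbT /=.
  move/chain_cat: hc => [m _ /= [h1 h2 h3 [h4 h5 h6 h7]]].
  lia.
have [j hk hk2] := @frontier_plain f' A0 a _ hpz.
by exists j, false; split=> //; rewrite size_rcons /=; lia.
Qed.

(** Otherwise the group opened by the last old boundary would lie beyond the cursor although it
    starts left of [f]. *)
Lemma frontier_lt f k fl H cur : frontier f k fl H -> 0 < cur ->
  all (fun z => f <= gid z) (drop cur H) -> k < cur.
Proof.
have key A g Z : A = [::] \/ gid g < f -> 0 < cur ->
    all (fun z => f <= gid z) (drop cur (A ++ g :: Z)) -> size A < cur.
  move=> hA h1 h0; case: hA => [-> //|hg]; rewrite ltnNge; apply/negP => hl.
  suff : f <= gid g by lia.
  move: h0; rewrite drop_cat; case: ltnP => hl2.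
    by rewrite all_cat /= => /and3P[].
  have -> : cur - size A = 0 by lia.
  by case/andP.
by case=> [A g Z h _|A g p Z h _ _]; apply: key.
Qed.

Lemma cat_split (T : Type) (X Y A R : seq T) g : X ++ g :: Y = A ++ R ->
  (exists A2, A = X ++ g :: A2) \/ (exists2 X2, X = A ++ X2 & X2 ++ g :: Y = R).
Proof.
elim: X A => [|x X IH] [|a A] /=.
- by move=> <-; right; exists [::].
- by case=> -> _; left; exists A.
- by move=> <-; right; exists (x :: X).
by case=> -> /IH [[A2 ->]|[X2 -> h]]; [left; exists A2 | right; exists X2].
Qed.

(** The place of the group containing [f] relative to the old and fresh boundaries; these five cases
    drive the analysis of a connection. *)
Variant located (f : nat) : nat -> bool -> seq group -> group -> seq group -> Prop :=
  | InOld A g Y of A = [::] \/ gid g < f & all (fun z => f <= gid z) Y :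
      located f (size A) false A g Y
  | InOldFresh A g p Z of A = [::] \/ gid g < f & gdeg p = (gdeg g).+1
        & all (fun z => f <= gid z) Z :
      located f (size A) true A g (p :: Z)
  | AfterOld A g' g Y of A = [::] \/ gid g' < f & gid g = f
        & all (fun z => f <= gid z) Y :
      located f (size A) false (rcons A g') g Y
  | InFresh A g' g Y of A = [::] \/ gid g' < f & gdeg g = (gdeg g').+1
        & all (fun z => f <= gid z) Y :
      located f (size A) true (rcons A g') g Y
  | AfterFresh A g' p g Y of A = [::] \/ gid g' < f & gdeg p = (gdeg g').+1
        & gid g = f & all (fun z => f <= gid z) Y :
      located f (size A) true (rcons (rcons A g') p) g Y.

(** No group of [A] contains [f], since the group after [A] starts before [f]; a group of [Z] can
    contain it only by starting at [f], and then it is the first of them. *)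
Lemma locate f k fl H s e X g Y : frontier f k fl H -> chain s H e ->
  H = X ++ g :: Y -> gid g <= f < gid g + gsize g -> located f k fl X g Y.
Proof.
have inA A R (hd : group) : chain s (A ++ hd :: R) e -> A = [::] \/ gid hd < f ->
    forall A2, A = X ++ g :: A2 -> gid g <= f < gid g + gsize g -> False.
  move=> hc hA A2 eA hf; subst A.
  case: hA => [|h]; first by case: (X).
  move: hc; rewrite -catA => /chain_cat[m _ /=] [_ h2 _ /chain_gid].
  by rewrite all_cat /= => /and3P[_ h3 _]; lia.
have inZ Z X2 : all (fun z => f <= gid z) Z -> X2 ++ g :: Y = Z ->
    forall s', chain s' Z e -> gid g <= f < gid g + gsize g -> 0 < s'.1.1 ->
    [/\ X2 = [::], Z = g :: Y & gid g = f].
  move=> hZ eZ s' hc hf hs; subst Z; case: X2 hZ hc => [|y X2] /=.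
    by case/andP=> h _ _; split=> //; lia.
  move=> /andP[h _] [h1 h2 h3 /chain_gid]; rewrite all_cat /= => /and3P[_ h4 _]; lia.
case=> [A h Z hA hZ|A h p Z hA hp hZ] hc e1 hf; have hc0 := hc.
  have [[A2 eA]|[X2 eX eZ]] := cat_split (esym e1).
    by case: (inA _ _ _ hc hA _ eA hf).
  case: X2 eX eZ => [|y X2] eX /=.
    by rewrite cats0 in eX; case=> eg eY; subst; apply: InOld.
  case=> ? eZ; subst y.
  move/chain_cat: hc => [m _ /= [_ _ _ hc]].
  have [//|e2 e3 e4] := inZ _ _ hZ eZ _ hc hf; subst X2 X.
  rewrite cats1; apply: AfterOld => //.
  by move: hZ; rewrite e3 /= => /andP[].
have [[A2 eA]|[X2 eX eZ]] := cat_split (esym e1).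
  by case: (inA _ _ _ hc hA _ eA hf).
case: X2 eX eZ => [|y X2] eX /=.
  by rewrite cats0 in eX; case=> eg eY; subst; apply: InOldFresh.
case=> ? eZ; subst y.
case: X2 eX eZ => [|y X2] eX /=.
  by case=> ? ?; subst; rewrite cats1; apply: InFresh.
case=> ? eZ; subst y.
move/chain_cat: hc => [m _ /= [_ _ _ [_ _ _ hc]]].
have [//|e2 e3 e4] := inZ _ _ hZ eZ _ hc hf; subst X2 X.
rewrite -cat_rcons cats1; apply: AfterFresh => //.
by move: hZ; rewrite e3 /= => /andP[].
Qed.

(** Source of the constant 3 in [potentials]: a cursor on the group containing [f] is at most
    [k + 3]. *)
Lemma located_bound f k fl X g Y : located f k fl X g Y -> size X <= k + fl + 1.
Proof. by case=> *; rewrite ?size_rcons; lia. Qed.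

(** * One step of EM-HH *)

Lemma frontier_head f k fl g g' T : gdeg g' = gdeg g ->
  frontier f k fl (g :: T) -> frontier f k fl (g' :: T).
Proof.
move=> hd; move eH: (g :: T) => H hf; case: hf eH => [A h Z hA hZ|A h p Z hA hp hZ].
  case: A hA => [|a A] hA [_ ->]; first by apply: (@Plain f [::]) => //; left.
  by apply: (@Plain f (g' :: A)) => //; right; case: hA.
case: A hA => [|a A] hA [e ->].
  by apply: (@Fresh f [::]) => //; [left | rewrite hp hd e].
by apply: (@Fresh f (g' :: A)) => //; right; case: hA.
Qed.

Definition g0 := Group 0 0 0.

(* While the cursor seeks to the left, [k] already has its new value; this is why
   [cur - 3] enters both potentials. *)
Definition potentials (k : nat) (fl : bool) (cur s x psi : nat) : Prop :=
  x = maxn k (cur - 3) /\ psi = s + maxn (k + ~~ fl) (cur - 3).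

(** [f] is the threshold that the frontier refers to; [b] bounds the first nodes of the stable
    groups from below. *)
Variant tracked (n : nat) (s : nat * nat * nat) (f b : nat) (G : seq group)
    (cur it k : nat) (fl : bool) (x psi : nat) : Prop :=
  Tracked of chain s (actual it cur G) n.+1 & frontier f k fl (actual it cur G)
    & 0 < cur <= size G & all (fun g => b <= gid g) (drop cur G)
    & potentials k fl cur (size G) x psi.

(** Each move to the left lowers the cursor, whereas at most one move to the right is made; hence
    [cur] enters only the first case. *)
Definition seek_measure (f cur : nat) (g : group) : nat :=
  if f < gid g then cur + 4 else if gid g + gsize g <= f then 4 else 3.

Definition round_start n u d G cur it x psi :=
  [/\ d = minn (gdeg (head g0 G)) (n - u), 0 < d
    & exists k fl, tracked n (0, u.+1, d) (n.+1 - d) (n.+1 - d) G cur it k fl x psi].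

(** The measure [mu] is lexicographic: rounds left, then progress within the round, with a weight
    [n + 10] that dominates the latter. In [Cleanup] the counter is taken one ahead, as the implicit
    decrement of the stable groups is already in force. *)
Definition hh_inv n G cur it ph x psi mu : Prop :=
  match ph with
  | Extract => exists u k fl,
      let f := n.+1 - minn (gdeg (head g0 G)) (n - u) in
      tracked n (1, u, 0) f f G cur it k fl x psi
      /\ mu = (n - u) * (n + 10) + (n + 10)
  | Seek u d => round_start n u d G cur it x psi
      /\ mu = (n - u) * (n + 10) + seek_measure (n.+1 - d) cur (nth g0 G cur.-1)
  | Connect u d => [/\ round_start n u d G cur it x psi,
      let g := nth g0 G cur.-1 in gid g <= n.+1 - d < gid g + gsize g
      & mu = (n - u) * (n + 10) + 2]
  | Cleanup => exists u f k fl,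
      [/\ tracked n (0, u.+1, 0) f (maxn f u.+2) G cur it.+1 k fl x psi,
          u < f, n.+1 - gdeg (head g0 G) <= f & mu = (n - u) * (n + 10) + 1]
  end.

Lemma size_actual it cur G : size (actual it cur G) = size G.
Proof. by rewrite size_cat size_map -size_cat cat_take_drop. Qed.

(** Stable groups start at or beyond [f], so [k < cur]. The potentials are thus determined up to
    constants by the cursor and the length, which is all that the cache analysis needs. *)
Lemma inv_bounds n G cur it ph x psi mu : hh_inv n G cur it ph x psi mu ->
  [/\ 0 < cur <= size G, cur <= x + 3, x <= cur, size G + x <= psi
    & psi <= (size G + x).+1].
Proof.
have key s f b k fl i : tracked n s f b G cur i k fl x psi -> f <= b ->
    [/\ 0 < cur <= size G, cur <= x + 3, x <= cur, size G + x <= psi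
      & psi <= (size G + x).+1].
  move=> [hc hf hcur hall [-> ->]] hb.
  have : k < cur.
    apply: (frontier_lt hf); first lia.
    rewrite /actual drop_cat size_take_min.
    have -> : minn cur (size G) = cur by lia.
    rewrite ltnn subnn drop0 all_gid_map.
    by apply: sub_all hall => z /=; lia.
  case: fl {hf} => /=; split; lia.
case: ph => [|u d|u d|] /=.
- by case=> u [k [fl [h _]]]; apply: (key _ _ _ _ _ _ h).
- by case=> [[_ _ [k [fl h]]] _]; exact: (key _ _ _ _ _ _ h (leqnn _)).
- by case=> [[_ _ [k [fl h]]] _ _]; exact: (key _ _ _ _ _ _ h (leqnn _)).
by case=> u [f [k [fl [h _ _ _]]]]; apply: (key _ _ _ _ _ _ h); lia.
Qed.

(** The head and the three cells around the cursor are the only ones a step ever inspects. *)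
Definition agree (L : seq (option group)) (G : seq group) (cur : nat) : Prop :=
  size L = size G /\
  {in [:: 0; cur.-2; cur.-1; cur], forall i, cell L i = cell (map Some G) i}.

Lemma cell_some G i : i < size G -> cell (map Some G) i = Some (nth g0 G i).
Proof. by move=> h; rewrite /cell (nth_map g0). Qed.

Definition edits n G cur it ph i j gs cur' it' ph' : Prop :=
  forall L out, agree L G cur -> exists out',
    hh_step n (HHState L cur it ph out)
      = Some (HHState (splice L i j gs) cur' it' ph' out').

Definition edited (G : seq group) i j gs : seq group := take i G ++ gs ++ drop j G.

(** Deleting the head costs the cache one head cell, so [Removal] records a drop of [x] that pays
    for it. *)
Variant edit_range (s cur cur' x x' i j : nat) (gs : seq group) : Prop :=
  | Front of i = 0 & j <= 1 & size gs = j & cur' = cur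
  | Removal of i = 0 & j = 1 & gs = [::] & cur' = cur.-1 & x' <= x.-1
  | Local of cur.-2 <= i <= j & j <= cur.+1 & j <= s & cur <= cur'.+1.

Definition hh_progress n G cur it ph x psi mu : Prop :=
  exists i j gs cur' it' ph', edits n G cur it ph i j gs cur' it' ph' /\
    (edited G i j gs = [::] \/ exists x' psi' mu',
      [/\ hh_inv n (edited G i j gs) cur' it' ph' x' psi' mu', mu' < mu, x' <= x,
          psi' <= psi & edit_range (size G) cur cur' x x' i j gs]).

Lemma progress_extract n G cur it x psi mu :
  hh_inv n G cur it Extract x psi mu -> hh_progress n G cur it Extract x psi mu.
Proof.
case=> u [k [fl []]]; set f := n.+1 - _; case=> hc hf hcur hall hpot hmu.
have hsz := chain_size hc isT; rewrite size_actual /= in hsz.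
case: G cur @f hsz hc hf hcur hall hpot => [|g T] [|c] //= hsz hc hf hcur hall hpot.
have [h1 h2 _ h3] := hc; rewrite /= in h1 h2 h3.
set d := minn (gdeg g) (n - u) in hf hall.
set g1 := Group u.+1 (gsize g).-1 (gdeg g).
have hun : u <= n by lia.
have hc1 lo : lo <= gdeg g -> chain (0, u.+1, lo) (actual it c.+1 (g1 :: T)) n.+1.
  move=> hlo; split=> //=.
  by have -> : u.+1 + (gsize g).-1 = u + gsize g by lia.
have hf1 : frontier (n.+1 - d) k fl (actual it c.+1 (g1 :: T)).
  exact: (@frontier_head _ _ _ g).
exists 0, 1, [:: g1], c.+1, it, (if d == 0 then Cleanup else Seek u d); split.
  move=> L out [hs hcell]; exists out.
  rewrite /hh_step [stage _]/= /extract_step hcell ?inE // cell_some //= h2 -/d -/g1 maxnE.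
  by have -> : c.+1 + (1 - c.+1) = c.+1 by lia.
have eG : edited (g :: T) 0 1 [:: g1] = g1 :: T by rewrite /edited /= drop0.
rewrite eG; right.
have hmu' : forall v, v < n + 10 -> (n - u) * (n + 10) + v < mu by move=> v; lia.
case: eqP => hd; last first.
  exists x, psi, ((n - u) * (n + 10) + seek_measure (n.+1 - d) c.+1 (nth g0 (g1 :: T) c)).
  split=> //; last exact: Front.
    split=> //; split=> //; first lia.
    by exists k, fl; split=> //; apply: hc1; lia.
  apply: hmu'; rewrite /seek_measure.
  by case: ifP => _; [|case: ifP => _]; lia.
(* With no requests the threshold is [n + 1], so no group is stable and the true degrees do not
   depend on the counter. *)
have hdrop : drop c T = [::].
  case E: (drop c T) hall => [|z Z] //= /andP[hz _].
  move: h3; rewrite E => /chain_cat[m /seg_pos hm /= [a1 a2 a3 /chain_end]] /=.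
  by have /= := hm isT; lia.
have eact i : actual i c.+1 (g1 :: T) = g1 :: T.
  rewrite /actual /= hdrop cats0 take_oversize //.
  by have := size_drop c T; rewrite hdrop /=; lia.
exists x, psi, ((n - u) * (n + 10) + 1); split=> //; [ | lia | exact: Front].
  exists u, n.+1, k, fl; split=> //=; try lia.
  split=> //; last by rewrite /= hdrop.
    by rewrite eact -(eact it); apply: hc1.
  by rewrite eact -(eact it); move: hf1; rewrite hd subn0.
Qed.

Lemma nth_mid (T : Type) (x : T) X g Y : nth x (X ++ g :: Y) (size X) = g.
Proof. by rewrite nth_cat ltnn subnn. Qed.

Lemma cell_mid X g Y : cell (map Some (X ++ g :: Y)) (size X) = Some g.
Proof. by rewrite /cell map_cat -(size_map Some X) nth_mid. Qed.

Lemma split_at (G : seq group) cur : 0 < cur <= size G ->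
  exists X g Y, G = X ++ g :: Y /\ cur = (size X).+1.
Proof.
case: cur => // c hc; exists (take c G), (nth g0 G c), (drop c.+1 G).
rewrite -drop_nth // cat_take_drop size_take_min; split=> //; lia.
Qed.

Lemma actual_mid it X g Y :
  actual it (size X).+1 (X ++ g :: Y) = X ++ g :: map (activate it) Y.
Proof. by rewrite -cat_rcons -(size_rcons X g) actual_cat cat_rcons. Qed.

Lemma edited_cat X A Y gs i j : size X = i -> i + size A = j ->
  edited (X ++ A ++ Y) i j gs = X ++ gs ++ Y.
Proof.
by move=> <- <-; rewrite /edited take_size_cat // -size_cat [X ++ A ++ Y]catA drop_size_cat.
Qed.

Lemma splice_nil (L : seq (option group)) : splice L 0 0 [::] = L.
Proof. by rewrite /splice take0 drop0. Qed.

Lemma edited_nil G : edited G 0 0 [::] = G.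
Proof. by rewrite /edited take0 drop0. Qed.

Lemma drop_mid (T : Type) (X : seq T) g Y : drop (size X).+1 (X ++ g :: Y) = Y.
Proof. by rewrite -cat_rcons -(size_rcons X g) drop_size_cat. Qed.

Lemma progress_seek n G cur it u d x psi mu :
  hh_inv n G cur it (Seek u d) x psi mu -> hh_progress n G cur it (Seek u d) x psi mu.
Proof.
case=> [[hd hd0 [k [fl [hc hf hcur hall hpot]]]] hmu].
have [X [g [Y [eG ecur]]]] := split_at hcur; subst G cur.
rewrite /= nth_mid in hmu; rewrite drop_mid in hall.
rewrite actual_mid in hc hf.
set f := n.+1 - d in hc hf hall hmu.
have [hlt|hge] := boolP (f < gid g); last rewrite -leqNgt in hge.
  case/lastP: X => [|X0 p] in hc hf hcur hpot hd hmu *.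
    (* The first group starts at [u + 1], and [u + 1 <= f] because [d <= n - u]; so a left move
       never leaves the list. *)
    by move: hc => /= [_ h _ _]; lia.
  exists (size X0).+1, (size X0).+2, [:: stabilize it g], (size X0).+1, it, (Seek u d).
  split.
    move=> L out [hs hcell]; exists out.
    rewrite /hh_step [stage _]/= /seek_step hcell ?inE ?eqxx ?orbT //.
    rewrite -/f [_.-1]/= cell_mid hlt size_rcons.
    by [].
  have -> : edited (rcons X0 p ++ g :: Y) (size X0).+1 (size X0).+2 [:: stabilize it g]
      = rcons X0 p ++ stabilize it g :: Y.
    by rewrite -cat1s edited_cat ?size_rcons //= addn1.
  right; exists (maxn k ((size X0).+1 - 3)).
  exists (size (rcons X0 p ++ g :: Y) + maxn (k + ~~ fl) ((size X0).+1 - 3)).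
  eexists; split=> /=.
  - split; last by [].
    split=> //.
      by move: hd; case: (X0).
    exists k, fl; rewrite -(size_rcons X0 p); split; rewrite ?actual_cat /= ?stabilizeK //.
    + by rewrite size_cat size_rcons /=; lia.
    + by rewrite drop_size_cat //= hall andbT; lia.
    + by rewrite !size_cat !size_rcons.
  - rewrite hmu /seek_measure -/f hlt size_rcons.
    by case: ifP => _; [|case: ifP => _]; lia.
  - by case: hpot => -> _; rewrite size_rcons; lia.
  - by case: hpot => _ ->; rewrite size_rcons !size_cat !size_rcons /=; lia.
  - by apply: Local; rewrite ?size_cat ?size_rcons /=; lia.
have enlt : (f < gid g) = false by lia.
have [hle|hgt] := boolP (gid g + gsize g <= f).
  have /chain_cat[m hm /= [h1 h2 h3 h4]] := hc.
  case: Y => [|q Y] in hc hf hcur hall hpot hd h4 *.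
    by move: h4 => /=; lia.
  have /andP[hq hY] := hall.
  have /= [h5 h6 h7 _] := h4.
  (* [q] was stable, so it starts at or beyond [f], while [g] ends by [f]: hence [q] starts exactly
     at [f]. Locating it bounds the new cursor by [k + 3], so neither potential grows. *)
  have hloc : size (rcons X g) <= k + fl + 1.
    apply: (@located_bound f k fl _ (activate it q) (map (activate it) Y)).
    apply: (locate hf hc); first by rewrite cat_rcons.
    by rewrite /=; lia.
  rewrite size_rcons in hloc.
  exists (size X).+1, (size X).+2, [:: activate it q], (size X).+2, it, (Seek u d).
  split.
    move=> L out [hs hcell]; exists out.
    rewrite /hh_step [stage _]/= /seek_step !hcell ?inE ?eqxx ?orbT //.
    rewrite -/f [_.-1]/= cell_mid enlt hle.
    by rewrite -cat_rcons -(size_rcons X g) cell_mid size_rcons.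
  have -> : edited (X ++ g :: q :: Y) (size X).+1 (size X).+2 [:: activate it q]
      = rcons X g ++ activate it q :: Y.
    by rewrite -cat_rcons -(cat1s q) edited_cat ?size_rcons //= addn1.
  right; exists (maxn k ((size X).+2 - 3)).
  exists (size (X ++ g :: q :: Y) + maxn (k + ~~ fl) ((size X).+2 - 3)).
  eexists; split=> /=.
  - split; last by [].
    split=> //; first by move: hd; rewrite cat_rcons; case: (X).
    exists k, fl; rewrite -(size_rcons X g); split; rewrite ?actual_mid /= ?cat_rcons //.
    + by rewrite size_cat size_rcons /=; lia.
    + by rewrite -cat_rcons drop_mid.
    + by rewrite !size_cat !size_rcons.
  - rewrite hmu /seek_measure -/f enlt hle -(size_rcons X g) nth_mid /=.
    by case: ifP => ?; [lia|case: ifP => ?; lia].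
  - by case: hpot => -> _; lia.
  - by case: hpot => _ ->; lia.
  - by apply: Local; rewrite ?size_cat ?size_rcons /=; lia.
exists 0, 0, [::], (size X).+1, it, (Connect u d); split.
  move=> L out [hs hcell]; exists out.
  rewrite /hh_step [stage _]/= /seek_step hcell ?inE ?eqxx ?orbT //.
  by rewrite -/f [_.-1]/= cell_mid enlt (negbTE hgt) splice_nil.
rewrite edited_nil; right; exists x, psi, ((n - u) * (n + 10) + 2); split=> //; last exact: Front.
  split; last by [].
    by split=> //; exists k, fl; split=> //; rewrite ?actual_mid ?drop_mid.
  by rewrite /= nth_mid -/f; lia.
by rewrite hmu /seek_measure -/f enlt (negbTE hgt) /=; lia.
Qed.

(** * Connecting a node: merges, splits and their effect on the frontier *)

Definition join (X : seq group) (g : group) : seq group :=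
  if X is x :: X' then belast x X' ++ merge (last x X') g else [:: g].

Lemma join_rcons X p g : join (rcons X p) g = X ++ merge p g.
Proof. by case: X => [|x X] //=; rewrite belast_rcons last_rcons. Qed.

(** The right half of a split meeting the groups after it: those receive their decrement here while
    [g] keeps its degree, so only the first of them can merge. *)
Definition absorb (g : group) (Y : seq group) : seq group :=
  if Y is q :: Y' then
    if gdeg q - 1 == gdeg g then
      Group (gid g) (gsize g + gsize q) (gdeg g) :: map dec Y'
    else g :: map dec Y
  else [:: g].

Lemma size_join X g : size X <= size (join X g) <= (size X).+1 /\ 0 < size (join X g).
Proof.
case/lastP: X => [|X p] //; rewrite join_rcons size_cat size_rcons /merge.
by case: ifP => _ /=; lia.
Qed.

Lemma chain_join s X g g' R e m : seg s X m ->
  m.1.1 <= gsize g' -> 0 < gsize g' -> gid g' = m.1.2 -> m.2 <= gdeg g -> 0 < gdeg g ->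
  gdeg g' = (gdeg g).-1 -> chain (1, gid g' + gsize g', gdeg g) R e ->
  chain (s.1, 0) (join X g' ++ R) e.
Proof.
move=> hX hz hs hb hlo hg hd hR.
case/lastP: X hX => [|X p] hX.
  move: hX => /= em; subst m; split=> //; first by rewrite -hb hd (ltn_predK hg).
rewrite join_rcons -catA; move: hX; rewrite -cats1 => /seg_cat[m0 h0 /= [h1 h2 h3 em]].
subst m; case: s h0 => -[z b] lo h0.
apply: (@chain_weak z b lo) => //; apply/chain_cat; exists m0 => //.
rewrite /= in hlo hb hz.
rewrite /merge; case: ifP => /eqP hm /=; split=> //=; try lia.
  have -> : (gdeg p).+1 = gdeg g by lia.
  by rewrite addnA -hb.
split=> //; rewrite -?hb //; first lia.
by have -> : (gdeg g').+1 = gdeg g by lia.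
Qed.

Lemma chain_absorb g Y e : 0 < gsize g -> chain (1, gid g + gsize g, (gdeg g).+1) Y e ->
  chain (1, gid g, gdeg g) (absorb g Y) e.
Proof.
move=> hs; case: Y => [|q Y] //= [h1 h2 h3 h4]; case: ifP => /eqP hq /=; split=> //=; try lia.
  have -> : (gdeg g).+1 = (gdeg q).+1.-1 by lia.
  by rewrite addnA; apply: (chain_dec _ h4).
split=> //=; first lia.
have -> : (gdeg q - 1).+1 = (gdeg q).+1.-1 by lia.
exact: (chain_dec _ h4).
Qed.

Lemma head_join X g R : X <> [::] ->
  gdeg (head g0 (join X g ++ R)) = gdeg (head g0 X).
Proof.
by case/lastP: X => // -[|x X] p _; rewrite join_rcons //= /merge; case: ifP.
Qed.

Lemma all_dec P Y : all (fun g => P (gid g)) (map dec Y) = all (fun g => P (gid g)) Y.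
Proof. exact: all_gid_map. Qed.

Definition charge (k : nat) (fl : bool) (cur s k' : nat) (fl' : bool) (cur' s' : nat) :=
  maxn k' (cur' - 3) <= maxn k (cur - 3) /\
  s' + maxn (k' + ~~ fl') (cur' - 3) <= s + maxn (k + ~~ fl) (cur - 3).

(* If [X] is empty, [u] connects to its own successor, whose degree drops by one. *)
Definition next_threshold (f : nat) (X : seq group) : nat := f + nilp X.

Lemma next_threshold0 f : next_threshold f [::] = f.+1.
Proof. exact: addn1. Qed.

Lemma next_threshold_rcons f X p : next_threshold f (rcons X p) = f.
Proof. by rewrite /next_threshold /nilp size_rcons addn0. Qed.

(** The boundary at [f], if any, loses one chip and no other gap changes. If it closes, the list
    gets shorter, which also pays for a fresh flag lost with it. *)
Lemma connect_whole f k fl X g Y : located f k fl X g Y -> gid g = f -> 0 < gdeg g ->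
  all (fun z => f < gid z) Y ->
  exists k' fl', frontier (next_threshold f X) k' fl' (join X (dec g) ++ map dec Y) /\
    charge k fl (size X).+1 (size (X ++ g :: Y)) k' fl'
      (size (join X (dec g))) (size (join X (dec g) ++ map dec Y)).
Proof.
case=> [A {}g {}Y hA hY|A {}g p Z hA hp hY|A g' {}g {}Y hA _ hY|A g' {}g {}Y hA hp hY|A g' p {}g {}Y hA hp _ hY] eg hg hlt.
- case: hA => [eA|]; last lia.
  subst A; exists 0, false; split; last by rewrite /charge /= size_map; lia.
  apply: (@Plain _ [::]); first by left.
  by rewrite all_dec next_threshold0.
- case: hA => [eA|]; last lia.
  subst A; exists 0, true; split; last by rewrite /charge /= size_map; lia.
  apply: (@Fresh _ [::]); first by left.
    by rewrite /=; lia.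
  by rewrite all_dec next_threshold0; case/andP: hlt.
- rewrite join_rcons /merge next_threshold_rcons -catA.
  case: ifP => /eqP hm; exists (size A), false.
    split; first by apply: Plain; rewrite ?all_dec.
    by rewrite /charge !size_cat /= size_rcons size_map; lia.
  split; first by apply: Plain; rewrite //= all_dec hY eg leqnn.
  by rewrite /charge !size_cat /= size_rcons size_map; lia.
- rewrite join_rcons /merge next_threshold_rcons -catA.
  have -> : gdeg g' == gdeg (dec g) by apply/eqP => /=; lia.
  exists (size A), false; split; first by apply: Plain; rewrite ?all_dec.
  by rewrite /charge !size_cat /= size_rcons size_map; lia.
rewrite join_rcons /merge next_threshold_rcons -catA cat_rcons.
case: ifP => /eqP hm; exists (size A), true.
  split; first by apply: Fresh; rewrite ?all_dec.
  by rewrite /charge !size_cat !size_rcons /= size_map; lia.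
split; first by apply: Fresh; rewrite //= all_dec hY eg leqnn.
by rewrite /charge !size_cat !size_rcons /= size_map; lia.
Qed.

Lemma absorbE g Y (P : pred nat) : all (fun z => P (gid z)) Y ->
  exists h Z, [/\ absorb g Y = h :: Z, gdeg h = gdeg g, size Z <= size Y
    & all (fun z => P (gid z)) Z].
Proof.
case: Y => [|q Y] hY; first by exists g, [::].
rewrite /absorb; case: ifP => _.
  exists (Group (gid g) (gsize g + gsize q) (gdeg g)), (map dec Y).
  by split; rewrite ?size_map ?all_dec //=; case/andP: hY.
by exists g, (map dec (q :: Y)); split; rewrite ?size_map ?all_dec.
Qed.

(** A split lengthens the list by one but raises the fresh flag. If a fresh boundary was already
    there, its gap of 1 closes on one side of [f] and takes back the extra group. *)
Lemma connect_part f k fl X g g1 g2 Y : located f k fl X g Y -> gid g < f ->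
  0 < gdeg g -> all (fun z => f < gid z) Y ->
  gid g1 = gid g -> gdeg g1 = (gdeg g).-1 -> gdeg g2 = gdeg g ->
  (forall X0 p, X = rcons X0 p -> gid p < f) ->
  exists k' fl', frontier (next_threshold f X) k' fl' (join X g1 ++ absorb g2 Y) /\
    charge k fl (size X).+1 (size (X ++ g :: Y)) k' fl'
      (size (join X g1)).+1 (size (join X g1 ++ absorb g2 Y)).
Proof.
move=> hl hgf hg hlt e1 d1 d2.
have [h [Z [eZ dh sZ aZ]]] := absorbE g2 hlt.
case: hl hgf hg hlt e1 d1 d2 eZ sZ => [A {}g {}Y hA hY|A {}g p W hA hp hY|A g' {}g {}Y hA eg hY|A g' {}g {}Y hA hp hY|A g' p {}g {}Y hA hp eg hY] hgf hg hlt e1 d1 d2 eZ sZ hX; try lia.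
- have aZ' : all (fun z => f <= gid z) Z by apply: sub_all aZ => z /=; lia.
  rewrite eZ; case/lastP: A hX hA => [|A p] hX hA.
    exists 0, true; split; last by rewrite /charge /=; lia.
    apply: (@Fresh _ [::]); [by left | lia | by rewrite next_threshold0].
  rewrite join_rcons /merge next_threshold_rcons -catA.
  case: ifP => /eqP hm /=.
    exists (size A), true; split; last by rewrite /charge !size_cat !size_rcons /=; lia.
    by apply: Fresh; rewrite //=; [right; apply: hX | lia].
  exists (size A).+1, true; split; last by rewrite /charge !size_cat !size_rcons /=; lia.
  rewrite -cat_rcons -(size_rcons A p); apply: Fresh => //; [right; lia | lia].
- have eW : absorb g2 (p :: W) = Group (gid g2) (gsize g2 + gsize p) (gdeg g2) :: map dec W.
    by rewrite /absorb; have -> : gdeg p - 1 == gdeg g2 by apply/eqP; lia.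
  have aW : all (fun z => f < gid z) (map dec W) by rewrite all_dec; case/andP: hlt.
  rewrite eW; case/lastP: A hX hA => [|A q] hX hA.
    exists 0, true; split; last by rewrite /charge /= size_map; lia.
    apply: (@Fresh _ [::]); [by left | rewrite /=; lia | by rewrite next_threshold0].
  have aW' : all (fun z => f <= gid z) (map dec W) by rewrite all_dec.
  rewrite join_rcons /merge next_threshold_rcons -catA.
  case: ifP => /eqP hm /=.
    exists (size A), true; split; last by rewrite /charge !size_cat !size_rcons /= size_map; lia.
    by apply: Fresh; rewrite //=; [right; apply: hX | lia].
  exists (size A).+1, true; split; last by rewrite /charge !size_cat !size_rcons /= size_map; lia.
  rewrite -cat_rcons -(size_rcons A q); apply: Fresh => //=; [right; lia | lia].
have aZ' : all (fun z => f <= gid z) Z by apply: sub_all aZ => z /=; lia.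
rewrite join_rcons /merge next_threshold_rcons -catA eZ.
have -> : gdeg g' == gdeg g1 by apply/eqP; lia.
exists (size A), true; split; last by rewrite /charge !size_cat !size_rcons /=; lia.
by apply: Fresh => //=; lia.
Qed.

Definition join_tail (X : seq group) (g : group) : seq group :=
  if X is x :: X' then merge (last x X') g else [:: g].

Lemma joinE X g : join X g = take (size X).-1 X ++ join_tail X g.
Proof. by case/lastP: X => [|X p] //; rewrite join_rcons /join_tail size_rcons -cats1 take_size_cat //; case: X => [|x X] //=; rewrite last_cat. Qed.

Lemma join_tail_cell L X g Y g' : agree L (X ++ g :: Y) (size X).+1 ->
  (if (size X).+1 == 1 then Some [:: g']
   else if cell L (size X).+1.-2 is Some p then Some (merge p g') else None)
  = Some (join_tail X g').
Proof.
case=> _ hcell; case/lastP: X hcell => [|X p] // hcell.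
rewrite hcell ?inE ?eqxx ?orbT // size_rcons [_.-2]/= cat_rcons cell_mid.
by case: X {hcell} => [|x X] //=; rewrite last_rcons.
Qed.

Lemma edited_join X g A Y g' gs :
  edited (X ++ g :: A ++ Y) (size X).-1 ((size X).+1 + size A) (join_tail X g' ++ gs)
  = join X g' ++ gs ++ Y.
Proof.
rewrite joinE /edited -cat_rcons [X in drop _ X]catA -(size_rcons X g) -size_cat drop_size_cat //.
by rewrite cat_rcons takel_cat ?leq_pred // -!catA.
Qed.

Lemma size_join_tail X g : (size X).-1 + size (join_tail X g) = size (join X g).
Proof. by rewrite joinE size_cat size_take_min; congr (_ + _); lia. Qed.

Lemma seg_le1 s X t : seg s X t -> s.1.1 <= 1 -> t.1.1 <= 1.
Proof. by elim: X s => [|g X IH] s /=; [move-> | case=> _ _ _ /IH /= h _; apply: h]. Qed.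

Lemma progress_connect n G cur it u d x psi mu :
  hh_inv n G cur it (Connect u d) x psi mu -> hh_progress n G cur it (Connect u d) x psi mu.
Proof.
case=> [[hd hd0 [k [fl [hc hf hcur hall hpot]]]]]; have := hd0.
have [X [g [Y0 [eG ecur]]]] := split_at hcur; subst G cur.
rewrite /= nth_mid; rewrite drop_mid in hall.
rewrite actual_mid in hc hf.
set f := n.+1 - d in hc hf hall *; move=> _ hfg hmu.
set Y := map (activate it) Y0 in hc hf.
have hl := locate hf hc erefl hfg.
have /chain_cat[m hX /= [m1 m2 m3 hY]] := hc; rewrite -m2 in hY.
have [/= m4 m5] := seg_mono hX.
have m6 := seg_le1 hX isT.
have hg : 0 < gdeg g by lia.
have hlt : all (fun z => f < gid z) Y.
  by apply: sub_all (chain_gid hY) => z /=; lia.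
have huf : u < f by lia.
have hgs : 0 < gsize g by lia.
(* Common end of the three outcomes: connection to the whole group, and a split with or without a
   merge to the right. [act] is the new active part. *)
have hfin act R0 k' fl' i j gs : edited (X ++ g :: Y0) i j gs = act ++ R0 ->
    chain (0, u.+1, 0) (act ++ map dec (map (activate it) R0)) n.+1 ->
    frontier (next_threshold f X) k' fl' (act ++ map dec (map (activate it) R0)) ->
    charge k fl (size X).+1 (size (X ++ g :: Y)) k' fl' (size act)
      (size (act ++ map dec (map (activate it) R0))) ->
    all (fun z => f < gid z) R0 -> 0 < size act -> size X <= size act ->
    n.+1 - gdeg (head g0 act) <= next_threshold f X ->
    i = (size X).-1 -> i <= j <= (size X).+2 -> j <= size (X ++ g :: Y0) ->
    (forall L out, agree L (X ++ g :: Y0) (size X).+1 -> exists out',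
      hh_step n (HHState L (size X).+1 it (Connect u d) out)
        = Some (HHState (splice L i j gs) (size act) it Cleanup out')) ->
    hh_progress n (X ++ g :: Y0) (size X).+1 it (Connect u d) x psi mu.
  move=> eG hc' hf' [hk1 hk2] hR hact hXact hhd hi hj hjs hstep.
  exists i, j, gs, (size act), it, Cleanup; split=> //; right.
  exists (maxn k' (size act - 3)), (size (act ++ R0) + maxn (k' + ~~ fl') (size act - 3)).
  exists ((n - u) * (n + 10) + 1).
  rewrite !size_cat /= !size_map in hk2.
  case: hpot => -> ->; rewrite eG; split=> //.
  - exists u, (next_threshold f X), k', fl'; split=> //.
    + split.
      * by rewrite actual_cat map_activateS; exact: hc'.
      * by rewrite actual_cat map_activateS; exact: hf'.
      * by rewrite size_cat leq_addr andbT; exact: hact.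
      * rewrite drop_size_cat //; apply: sub_all hR => z /=.
        by move: huf; clear; rewrite /next_threshold; case: (nilp X) => /=; lia.
      * by split.
    + by move: huf; clear; rewrite /next_threshold; lia.
    + by move: hhd; case: (act) hact.
  - by rewrite hmu; clear; lia.
  - by move: hk2; rewrite !size_cat /=; clear; lia.
  - by move: hXact hi hj hjs; clear; move=> *; apply: Local; lia.
have hR0 : all (fun z => f < gid z) Y0 by rewrite -(@all_gid_map (fun i => f < i) it).
(* With [X] empty the head itself loses one degree and the threshold grows by one to match;
   otherwise the head keeps its degree. *)
have hhd g' R : gdeg g' = (gdeg g).-1 ->
    n.+1 - gdeg (head g0 (join X g' ++ R)) <= next_threshold f X.
  move=> hg'; case: (X) hd => [|y X'] hd.
    by move: hd; rewrite next_threshold0 /= hg' /f; clear; lia.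
  by move: hd; rewrite head_join // /next_threshold addn0 /f /=; clear; lia.
have [ef|nef] := eqVneq f (gid g).
  have [k' [fl' [hf' hk']]] := connect_whole hl (esym ef) hg hlt.
  have [hs1 hs2] := size_join X (dec g).
  apply: (hfin (join X (dec g)) Y0 k' fl' (size X).-1 (size X).+1 (join_tail X (dec g))) => //; try lia.
  - by have := @edited_join X g [::] Y0 (dec g) [::]; rewrite /= addn0 cats0.
  - apply: (chain_join (g := g) hX) => //=; [by rewrite subn1 | exact: (chain_dec _ hY)].
  - by rewrite -[join X (dec g)]cats0; apply: hhd => /=; rewrite subn1.
  move=> L out hag; have [hs hcell] := hag.
  rewrite /hh_step [stage _]/= /connect_step; cbv zeta beta.
  rewrite hcell ?inE ?eqxx ?orbT // [_.-1]/= cell_mid -/f ef eqxx.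
  have -> : Group (gid g) (gsize g) (gdeg g).-1 = dec g by rewrite /dec /activate subn1.
  rewrite (join_tail_cell _ hag) -size_join_tail; eexists; reflexivity.
set a := gid g + gsize g - f.
set g1 := Group (gid g) a (gdeg g).-1.
set g2 := Group (gid g + a) (gsize g - a) (gdeg g).
have hgf : gid g < f by lia.
have hprev X0 p : X = rcons X0 p -> gid p < f.
  move=> eX; move: hX; rewrite eX -cats1 => /seg_cat[m' _ /= [_ b1 _ b2]].
  by move: m2; rewrite -b2 /=; lia.
have [k' [fl' [hf' hk']]] :=
  connect_part (g1 := g1) (g2 := g2) hl hgf hg hlt erefl erefl erefl hprev.
have hc' : chain (0, u.+1, 0) (join X g1 ++ absorb g2 Y) n.+1.
  apply: (chain_join (g := g) hX) => //=; try lia.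
  apply: (@chain_absorb g2) => /=; first lia.
  by have -> : gid g + a + (gsize g - a) = gid g + gsize g by lia.
have [hs1 hs2] := size_join X g1.
have hmid (R0 : seq group) g' : absorb g2 Y = g' :: map dec (map (activate it) R0) ->
    join X g1 ++ absorb g2 Y = rcons (join X g1) g' ++ map dec (map (activate it) R0).
  by move=> ->; rewrite cat_rcons.
have hstep L out : agree L (X ++ g :: Y0) (size X).+1 -> exists out',
    hh_step n (HHState L (size X).+1 it (Connect u d) out) =
      if Y0 is q :: _ then
        if (gdeg (activate it q)).-1 == gdeg g2 then
          Some (HHState (splice L (size X).-1 (size X).+2 (join_tail X g1 ++
              [:: Group (gid g2) (gsize g2 + gsize q) (gdeg g2)]))
            (size (join X g1)).+1 it Cleanup out')
        else Some (HHState (splice L (size X).-1 (size X).+1 (join_tail X g1 ++ [:: g2]))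
               (size (join X g1)).+1 it Cleanup out')
      else Some (HHState (splice L (size X).-1 (size X).+1 (join_tail X g1 ++ [:: g2]))
               (size (join X g1)).+1 it Cleanup out').
  move=> hag; have [hs hcell] := hag.
  rewrite /hh_step [stage _]/= /connect_step; cbv zeta beta.
  rewrite hcell ?inE ?eqxx ?orbT // [_.-1]/= cell_mid -/f (negbTE nef) -/a -/g1 -/g2.
  rewrite (join_tail_cell _ hag) hcell ?inE ?eqxx ?orbT //.
  rewrite -size_join_tail hs !cats1 addnS.
  case: (Y0) => [|q Y0']; first by rewrite size_cat addn1 ltnn; eexists; reflexivity.
  have -> : ((size X).+1 < size (X ++ g :: q :: Y0')) = true.
    by rewrite size_cat /= !addnS !ltnS leq_addr.
  have -> : cell (map Some (X ++ g :: q :: Y0')) (size X).+1 = Some q.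
    by rewrite -cat_rcons -(size_rcons X g) cell_mid.
  by rewrite ?cats1; case: ifP => _; eexists; reflexivity.
have hplain : absorb g2 Y = g2 :: map dec (map (activate it) Y0) ->
    (forall L out, agree L (X ++ g :: Y0) (size X).+1 -> exists out',
      hh_step n (HHState L (size X).+1 it (Connect u d) out)
        = Some (HHState (splice L (size X).-1 (size X).+1 (join_tail X g1 ++ [:: g2]))
               (size (join X g1)).+1 it Cleanup out')) ->
    hh_progress n (X ++ g :: Y0) (size X).+1 it (Connect u d) x psi mu.
  move=> e hst; rewrite (hmid _ _ e) in hf' hk' hc'.
  rewrite -(size_rcons (join X g1) g2) in hk' hst.
  apply: (hfin _ _ _ _ _ _ _ _ hc' hf' hk' _ _ _ _ erefl _ _ hst) => //; rewrite ?size_rcons; try lia.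
  - by have := @edited_join X g [::] Y0 g1 [:: g2]; rewrite /= addn0 => ->; rewrite cat_rcons.
  - by rewrite -cats1; apply: hhd.
case: Y0 @Y hc hf hl hY hlt hc' hf' hk' hmid hstep hplain hfin hR0 hall hcur hpot hd
  => [|q Y1] Y hc hf hl hY hlt hc' hf' hk' hmid hstep hplain hfin hR0 hall hcur hpot hd.
  exact: hplain.
case hq : ((gdeg (activate it q)).-1 == gdeg g2); last first.
  apply: hplain; last by move=> L out /hstep; rewrite hq.
  by move: hq; rewrite /Y /= subn1 => ->.
have e : absorb g2 Y = Group (gid g2) (gsize g2 + gsize q) (gdeg g2)
    :: map dec (map (activate it) Y1).
  by move: hq; rewrite /Y /= subn1 => ->.
set g3 := Group _ _ _ in e.
have hst L out : agree L (X ++ g :: q :: Y1) (size X).+1 -> exists out',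
    hh_step n (HHState L (size X).+1 it (Connect u d) out)
      = Some (HHState (splice L (size X).-1 (size X).+2 (join_tail X g1 ++ [:: g3]))
          (size (rcons (join X g1) g3)) it Cleanup out').
  by move=> /hstep; rewrite hq size_rcons.
rewrite (hmid _ _ e) in hf' hk' hc'.
rewrite -(size_rcons (join X g1) g3) in hk'.
apply: (hfin _ _ _ _ _ _ _ _ hc' hf' hk' _ _ _ _ erefl _ _ hst) => //; rewrite ?size_rcons; try lia.
- by have := @edited_join X g [:: q] Y1 g1 [:: g3]; rewrite /= addn1 => ->; rewrite cat_rcons.
- by case/andP: hR0.
- by rewrite -cats1; apply: hhd.
by rewrite size_cat /= !addnS !ltnS leq_addr.
Qed.

(** The threshold can move right only from [u + 1] to [u + 2]. No old boundary lies left of it then,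
    and all groups but the first start at [u + 2] or later, so the frontier is unaffected. *)
Lemma frontier_next u lo f f' k fl H e : chain (1, u.+1, lo) H e ->
  frontier f k fl H -> u < f -> f' <= maxn f u.+2 ->
  exists k' fl', [/\ frontier f' k' fl' H, k' <= k & k' + ~~ fl' <= k + ~~ fl].
Proof.
move=> hc hf huf hf'.
have [hle|hgt] := leqP f' f; first exact: (frontier_le hle hf hc).
have hf2 : f' <= u.+2 by lia.
have noA A g Z : H = A ++ g :: Z -> A = [::] \/ gid g < f -> A = [::].
  move=> eH [] // hg; move: (chain_gid hc); rewrite eH all_cat /= => /and3P[_ h _].
  lia.
case: hf hc noA => [A g Z hA hZ|A g p Z hA hp hZ] hc noA.
  have eA := noA _ _ _ erefl hA; subst A.
  exists 0, false; split=> //; apply: (@Plain _ [::]); first by left.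
  by move: hc => /= [h1 h2 h3 /chain_gid]; apply: sub_all => z /=; lia.
have eA := noA _ _ _ erefl hA; subst A.
exists 0, true; split=> //; apply: (@Fresh _ [::]) => //; first by left.
move: hc => /= [h1 h2 h3 [h4 h5 h6 /chain_gid]].
by apply: sub_all => z /=; lia.
Qed.

(** An old boundary disappears with the first group when there is one. Otherwise the fresh one may
    go and the flag falls; [.-1.+1] allows for the resulting value 1, and the shorter list makes up
    for it. *)
Lemma frontier_behead f k fl g H : frontier f k fl (g :: H) -> H <> [::] ->
  exists k' fl', [/\ frontier f k' fl' H, k' <= k.-1 & k' + ~~ fl' <= (k + ~~ fl).-1.+1].
Proof.
move eGH: (g :: H) => GH hf; case: hf eGH => [A h Z hA hZ|A h p Z hA hp hZ].
  case: A hA => [|a A] hA [_ eH] hH; subst H.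
    case: Z hZ hH => // h' Z /= /andP[_ hZ] _.
    by exists 0, false; split=> //; apply: (@Plain _ [::]) => //; left.
  by exists (size A), false; split=> //=; [apply: Plain => //; right; case: hA].
case: A hA => [|a A] hA [_ eH] hH; subst H.
  by exists 0, false; split=> //; apply: (@Plain _ [::]) => //; left.
by exists (size A), true; split=> //=; [apply: Fresh => //; right; case: hA].
Qed.

Lemma progress_cleanup n G cur it x psi mu :
  hh_inv n G cur it Cleanup x psi mu -> hh_progress n G cur it Cleanup x psi mu.
Proof.
case=> u [f [k [fl [[hc hf hcur hall hpot] huf hdeg hmu]]]].
have hsteps L out : agree L G cur ->
    hh_step n (HHState L cur it Cleanup out) =
      if gsize (head g0 G) == 0 then Some (HHState (splice L 0 1 [::]) cur.-1 it.+1 Extract out)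
      else Some (HHState (splice L 0 0 [::]) cur it.+1 Extract out).
  move=> [hs hcell]; rewrite /hh_step [stage _]/= /cleanup_step hcell ?inE // cell_some; last lia.
  by rewrite nth0 splice_nil /splice take0 /= -drop1.
(* The [n + 10] of the next [Extract] is paid by the drop of [n - u]; the 1 of [Cleanup] makes the
   inequality strict. *)
have hmeas : u < n -> (n - u.+1) * (n + 10) + (n + 10) < mu.
  by move=> hun; rewrite hmu (_ : n - u = (n - u.+1).+1) ?mulSn; lia.
case hz : (gsize (head g0 G) == 0) hsteps => hsteps; last first.
  exists 0, 0, [::], cur, it.+1, Extract; split.
    by move=> L out /hsteps ->; exists out.
  rewrite edited_nil; right.
  have hc1 : chain (1, u.+1, 0) (actual it.+1 cur G) n.+1.
    by case: G cur hc hcur hz {hf hall hpot hdeg hsteps} => [|g T] [|c] //= [h1 h2 h3 h4] _; split=> //; lia.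
  have hsz := chain_size hc1 isT; rewrite size_actual /= in hsz.
  have [|k' [fl' [hf' hk1 hk2]]] := @frontier_next _ _ _
     (n.+1 - minn (gdeg (head g0 G)) (n - u.+1)) _ _ _ _ hc1 hf huf; first by lia.
  exists (maxn k' (cur - 3)), (size G + maxn (k' + ~~ fl') (cur - 3)).
  exists ((n - u.+1) * (n + 10) + (n + 10)); case: hpot => -> ->; split; try lia.
    exists u.+1, k', fl'; split=> //; split=> //.
    by apply: sub_all hall => z /=; lia.
  exact: Front.
exists 0, 1, [::], cur.-1, it.+1, Extract; split.
  by move=> L out /hsteps ->; exists out.
have -> : edited G 0 1 [::] = behead G by rewrite /edited take0 drop1.
case: G cur hc hf hcur hall hpot hdeg hz {hsteps} => [|g [|h T]] [|[|c]] //; try by left.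
  (* Cursor 1 with an empty head and a second group is impossible: that group would be stable and
     start at [u + 1], but stable groups start at [u + 2] or later. *)
  move=> [h1 h2 h3 [h4 h5 h6 h7]] _ _ /= /andP[h8 _] _ _ /eqP h9.
  by move: h5 h8 => /=; lia.
move=> hc hf hcur hall hpot hdeg /eqP hz; right.
have [k1 [fl1 [hf1 hk1 hk2]]] := frontier_behead hf (ltac:(by [])).
have [h1 h2 h3 h4] := hc.
have hc1 : chain (1, u.+1, (gdeg g).+1) (actual it.+1 c.+1 (h :: T)) n.+1.
  by move: h4; rewrite /= in hz *; rewrite hz addn0.
have hsz := chain_size hc1 isT; rewrite size_actual /= in hsz.
have hgh : gdeg g < gdeg h by move: hc1 => /= [].
rewrite /= in hdeg.
have [|k' [fl' [hf' hk3 hk4]]] := @frontier_next _ _ _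
   (n.+1 - minn (gdeg h) (n - u.+1)) _ _ _ _ hc1 hf1 huf; first by lia.
exists (maxn k' (c.+1 - 3)), (size (h :: T) + maxn (k' + ~~ fl') (c.+1 - 3)).
exists ((n - u.+1) * (n + 10) + (n + 10)); case: hpot => -> -> /=; split; try lia.
  exists u.+1, k', fl'; split=> //; split=> //.
    by apply: chain_weak hc1.
  by apply: sub_all hall => z /=; lia.
by apply: Removal => //; lia.
Qed.

Lemma inv_progress n G cur it ph x psi mu :
  hh_inv n G cur it ph x psi mu -> hh_progress n G cur it ph x psi mu.
Proof.
case: ph => [|u d|u d|].
- exact: progress_extract.
- exact: progress_seek.
- exact: progress_connect.
exact: progress_cleanup.
Qed.

(** * The initial group list *)

Lemma chain_initial b lo D : sorted leq D -> all (leq lo) D ->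
  chain (1, b.+1, lo) [seq Group (b + index x D).+1 (count_mem x D) x | x <- undup D]
    (b + size D).+1.
Proof.
elim: D b lo => [|x s IH] b lo /=; first by rewrite addn0.
move=> hs /andP[hx hlo]; have hmin := order_path_min leq_trans hs.
have shift (t : seq nat) : x \notin t ->
    [seq Group (b + (if x == z then 0 else (index z s).+1)).+1 ((x == z) + count_mem z s) z
      | z <- t] = [seq Group (b.+1 + index z s).+1 (count_mem z s) z | z <- t].
  move=> hxt; apply/eq_in_map => z hz.
  have -> : (x == z) = false by apply: contraNF hxt => /eqP ->.
  by rewrite addnS.
case: ifP => hxs; last first.
  have /(IH b.+1 _ (path_sorted hs)) : all (leq x.+1) s.
    apply/allP => z hz; rewrite ltn_neqAle (allP hmin _ hz) andbT.
    by apply: contraFneq hxs => ->.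
  rewrite /= eqxx addn0 addSnnS shift ?mem_undup ?hxs // => hc; split=> //=.
  have -> : count_mem x s = 0 by apply/count_memPn; rewrite hxs.
  by rewrite addn0 addn1.
have := IH b.+1 lo (path_sorted hs) hlo.
have := undup_uniq s; have := mem_undup s.
case: (undup s) => [|y t] hmem; first by have := hmem x; rewrite hxs.
move=> /= /andP[hyt _] [h1 h2 h3 h4].
have hy : y \in s by rewrite -hmem mem_head.
(* [undup] keeps last occurrences, so a repeated [x] must be shown to head [undup s]. The chain
   forces index 0 for that head, hence it is the first and least element of [s]. *)
have exy : y = x.
  apply/eqP; rewrite eqn_leq (allP hmin _ hy) andbT.
  have hi : index y s = 0 by lia.
  move: hi hxs hs {IH hmin shift hmem h1 h2 h3 h4 hlo hy}.
  case: s => //= y' s; case: eqP => // -> _.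
  rewrite in_cons => /orP[/eqP -> //|hxs] /andP[_ hs].
  exact: (allP (order_path_min leq_trans hs) _ hxs).
subst y; rewrite eqxx addn0 shift //; split=> //=.
by move: h4; rewrite add1n -addSnnS -addSnnS.
Qed.

Lemma inv_initial D : D <> [::] -> sorted leq D ->
  let G := initial_groups D in
  exists x psi mu, [/\ hh_inv (size D) G (size G) 0 Extract x psi mu,
    x <= size G & psi <= (size G + x).+1].
Proof.
move=> hD hs G.
have hc : chain (1, 1, 0) G (size D).+1.
  by have := chain_initial 0 hs (lo := 0); apply; apply/allP.
have eact it : actual it (size G) G = G.
  by rewrite /actual take_size drop_size cats0.
have hG : G <> [::].
  by move: hc; case: G {eact} => //= -[] h; case: (D) hD h.
have [A [g eG]] : exists A g, G = rcons A g.
  by case/lastP: (G) hG => // A g _; exists A, g.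
set f := (size D).+1 - minn (gdeg (head g0 G)) (size D - 1).
have [k hk hf] := @frontier_plain f A g [::] isT.
rewrite cats1 -eG in hf.
have hsz : size G = (size A).+1 by rewrite eG size_rcons.
exists (maxn k (size G - 3)), (size G + maxn (k + 1) (size G - 3)).
exists ((size D - 1) * (size D + 10) + (size D + 10)); split; try lia.
exists 1, k, false; split=> //; split; rewrite ?eact ?drop_size //.
by rewrite hsz leqnn.
Qed.

(** * Residency and transfers *)

(* [ms] marks the groups of [G] that are in internal memory. *)
Definition resident (G : seq group) (ms : bitseq) : seq (option group) :=
  [seq if p.2 then Some p.1 else None | p <- zip G ms].

Definition on_disk (G : seq group) (ms : bitseq) : seq group := mask (map negb ms) G.

Lemma resident0 ms : resident [::] ms = [::].
Proof. by case: ms. Qed.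

Lemma transfer_cells_resident G ms keep D2 : size ms = size G -> size keep = size G ->
  transfer_cells (resident G ms) keep (on_disk G ms ++ D2) = resident G keep.
Proof.
elim: G ms keep => [|g G IH] [|b ms] [|k keep] //= [hm] [hk].
by case: b; case: k; rewrite /= IH.
Qed.

Lemma transfer_requests_apply G ms keep D1 D2 : size ms = size G -> size keep = size G ->
  let rs := transfer_requests (resident G ms) keep (size D1) in
  valid_requests (D1 ++ on_disk G ms ++ D2) rs /\
  foldl (@apply_request group) (D1 ++ on_disk G ms ++ D2) rs = D1 ++ on_disk G keep ++ D2.
Proof.
elim: G ms keep D1 => [|g G IH] [|b ms] [|k keep] D1 //= [hm] [hk].
case: b; case: k => /=.
- exact: IH.
- rewrite take_size_cat // drop_size_cat // size_cat leq_addr /=.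
  rewrite -[D1 ++ g :: _]cat_rcons -[D1 ++ g :: on_disk G keep ++ D2]cat_rcons.
  by rewrite -(size_rcons D1 g); apply: IH.
- rewrite size_cat /= addnS ltnS leq_addr /=.
  have -> : take (size D1) (D1 ++ g :: on_disk G ms ++ D2) = D1 by rewrite take_size_cat.
  have -> : drop (size D1).+1 (D1 ++ g :: on_disk G ms ++ D2) = on_disk G ms ++ D2.
    by rewrite -cat_rcons -(size_rcons D1 g) drop_size_cat.
  exact: IH.
- rewrite -[D1 ++ g :: _]cat_rcons -[D1 ++ g :: on_disk G keep ++ D2]cat_rcons.
  by rewrite -(size_rcons D1 g); apply: IH.
Qed.

Lemma transfer_requests_cat G1 G2 ms1 ms2 k1 k2 D1 :
  size ms1 = size G1 -> size k1 = size G1 ->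
  transfer_requests (resident (G1 ++ G2) (ms1 ++ ms2)) (k1 ++ k2) (size D1) =
  transfer_requests (resident G1 ms1) k1 (size D1) ++
  transfer_requests (resident G2 ms2) k2 (size (D1 ++ on_disk G1 k1)).
Proof.
elim: G1 ms1 k1 D1 => [|g G1 IH] [|b ms1] [|k k1] D1 //=; first by rewrite cats0.
move=> [hm] [hk]; case: b; case: k => /=; rewrite -?(size_rcons D1 g) IH //=;
  by rewrite ?cat_rcons.
Qed.

(** Loads all happen at one position and evictions at consecutive ones, so a block whose old and new
    residency are both uniform is served without seeking. *)
Lemma transfer_requests_const G l b k p : size G = l ->
  let rs := transfer_requests (resident G (nseq l b)) (nseq l k) p in
  [/\ sequential rs, size rs <= 2 * l & b = k -> rs = [::]].
Proof.
elim: G l p => [|g G IH] [|l] p //= [hl].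
case: b IH; case: k => IH /=; rewrite -/(resident _ _); have [h1 h2 h3] := IH l p hl.
- by split; [exact: h1 | lia | move=> _; exact: h3].
- have [h4 h5 _] := IH l p.+1 hl; split; [ | by lia | by []].
  case: G l hl h4 {IH h1 h2 h3 h5} => [|g' G] [|l] //= _ ->.
  by rewrite /adjacent /=; lia.
- split; [ | by lia | by []].
  case: G l hl h1 {IH h2 h3} => [|g' G] [|l] //= _; rewrite /adjacent /= ?andbT; first by lia.
  by move=> ->; lia.
- by have [h4 h5 h6] := IH l p.+1 hl; split; [exact: h4 | lia | move=> _; exact: h6].
Qed.

Lemma leq_scan B k l : k <= l -> scan B k <= scan B l.
Proof. by move=> h; apply: leq_div2r; lia. Qed.

Definition expand (rl : seq (nat * bool)) : bitseq := flatten [seq nseq p.1 p.2 | p <- rl].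

Section Machine.
Variables (c B : nat) (E : emlist group c B).
Implicit Types s : em_state E.

Lemma cost_cat s rs1 rs2 : cost s (rs1 ++ rs2) = cost s rs1 + cost (execute s rs1) rs2.
Proof. by elim: rs1 s => [|r rs1 IH] s //=; rewrite -addnA -IH. Qed.

Lemma items_execute s rs : valid_requests (em_items s) rs ->
  em_items (execute s rs) = foldl (@apply_request group) (em_items s) rs.
Proof.
elim: rs s => [|r rs IH] s //= /andP[h1 h2].
by rewrite -(em_items_exec h1) -IH // em_items_exec.
Qed.

Lemma items_transfer s G ms keep D1 D2 : size ms = size G -> size keep = size G ->
  em_items s = D1 ++ on_disk G ms ++ D2 ->
  let rs := transfer_requests (resident G ms) keep (size D1) in
  valid_requests (em_items s) rs /\ em_items (execute s rs) = D1 ++ on_disk G keep ++ D2.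
Proof.
move=> hm hk hs; have [h1 h2] := transfer_requests_apply D1 D2 hm hk.
by rewrite -hs in h1 h2; split=> //; rewrite items_execute.
Qed.

(** Cutting off the shorter of the two leading runs exhausts one of them, so at most [n] uniform
    pieces arise. A piece that changes residency is cached on one side, so it has at most [N] cells
    and [2 * N] requests, served by one scan. *)
Lemma cost_transfer N n rl1 rl2 s G D1 D2 :
  size rl1 + size rl2 <= n -> size (expand rl1) = size G -> size (expand rl2) = size G ->
  count id (expand rl1) <= N -> count id (expand rl2) <= N ->
  em_items s = D1 ++ on_disk G (expand rl1) ++ D2 ->
  cost s (transfer_requests (resident G (expand rl1)) (expand rl2) (size D1))
    <= n * (c * scan B (2 * N)).
Proof.
elim: n rl1 rl2 s G D1 => [|n IH] rl1 rl2 s G D1.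
  by case: rl1; case: rl2 => //= _ /esym /size0nil ->.
case: rl1 => [|[l1 b1] rl1]; first by move=> _ /esym /size0nil ->.
case: rl2 => [|[l2 b2] rl2]; first by move=> _ _ /esym /size0nil ->; rewrite resident0.
set l := minn l1 l2.
pose f1 := if l1 <= l2 then rl1 else (l1 - l2, b1) :: rl1.
pose f2 := if l1 <= l2 then (l2 - l1, b2) :: rl2 else rl2.
have e1 : expand ((l1, b1) :: rl1) = nseq l b1 ++ expand f1.
  rewrite /f1 /l; case: leqP => h //.
  by rewrite /expand /= catA -nseqD subnKC // ltnW.
have e2 : expand ((l2, b2) :: rl2) = nseq l b2 ++ expand f2.
  rewrite /f2 /l; case: leqP => h //.
  by rewrite /expand /= catA -nseqD subnKC.
have hf : (size f1 + size f2).+1 <= size ((l1, b1) :: rl1) + size ((l2, b2) :: rl2).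
  by rewrite /f1 /f2; case: ifP => _ /=; lia.
rewrite e1 e2 => hn h1 h2 c1 c2 hs.
have hl : l <= size G by move: h1; rewrite size_cat size_nseq; lia.
rewrite -(cat_take_drop l G) in h1 h2 hs *.
set G1 := take l G in h1 h2 hs *; set G2 := drop l G in h1 h2 hs *.
have hG1 : size G1 = l by rewrite size_takel.
have [z1 z2] : size (nseq l b1) = size G1 /\ size (nseq l b2) = size G1.
  by rewrite !size_nseq.
rewrite !size_cat !size_nseq hG1 in h1 h2.
rewrite !count_cat !count_nseq /= in c1 c2.
rewrite transfer_requests_cat // cost_cat mulSn.
have hs' : em_items s = D1 ++ on_disk G1 (nseq l b1) ++ (on_disk G2 (expand f1) ++ D2).
  by rewrite hs /on_disk map_cat mask_cat ?size_map // -catA.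
have [v1 v2] := items_transfer z1 z2 hs'.
have [q1 q2 q3] := transfer_requests_const b1 b2 (size D1) hG1.
apply: leq_add.
  case: (eqVneq b1 b2) => hb; first by rewrite q3.
  apply: leq_trans (em_scan v1 q1) _; rewrite leq_mul2l leq_scan ?orbT //.
  apply: leq_trans q2 _; rewrite leq_mul2l /=.
  move: hb c1 c2; move: (count _ _) (count _ _) (l) => x y l'; clear.
  by case: b1; case: b2 => //= _; lia.
apply: IH; try lia.
by rewrite v2 catA.
Qed.

Lemma store_groups (s : em_state E) gs : em_items s = [::] ->
  let rs := [seq Insert p.1 p.2 | p <- zip (iota 0 (size gs)) gs] in
  em_items (execute s rs) = gs /\ cost s rs <= c * scan B (size gs).
Proof.
move=> hs.
have key (l : seq group) (k : nat) : k = size l ->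
    let rs := [seq Insert p.1 p.2 | p <- zip (iota k (size gs)) gs] in
    [/\ valid_requests l rs, foldl (@apply_request group) l rs = l ++ gs,
      forall r, position r = k.-1 -> path (@adjacent group) r rs & size rs = size gs].
  elim: gs l k => [|g gs IH] l k hk /=; first by rewrite cats0.
  rewrite hk take_size drop_size cats1 leqnn /= -hk.
  have [|h1 h2 h3 h4] := IH (rcons l g) k.+1; first by rewrite size_rcons hk.
  split=> //; [by rewrite h2 cat_rcons | | by rewrite h4].
  by move=> r hr; rewrite h3 // /adjacent hr /=; lia.
have [h1 h2 h3 h4] := key [::] 0 erefl; rewrite -hs in h1 h2.
split; first by rewrite items_execute // h2 hs.
rewrite -{2}h4; apply: em_scan => //.
have h : sequential (Read 0 :: [seq Insert p.1 p.2 | p <- zip (iota 0 (size gs)) gs]).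
  exact: h3.
exact: path_sorted h.
Qed.

End Machine.

Definition replace (ms : bitseq) i j k : bitseq := take i ms ++ nseq k true ++ drop j ms.

Lemma resident_cat G1 G2 ms1 ms2 : size ms1 = size G1 ->
  resident (G1 ++ G2) (ms1 ++ ms2) = resident G1 ms1 ++ resident G2 ms2.
Proof. by move=> h; rewrite /resident zip_cat // map_cat. Qed.

Lemma resident_true G : resident G (nseq (size G) true) = map Some G.
Proof. by elim: G => //= g G <-. Qed.

Lemma size_resident G ms : size ms = size G -> size (resident G ms) = size G.
Proof. by move=> h; rewrite size_map size_zip h minnn. Qed.

Lemma take_resident G ms i : take i (resident G ms) = resident (take i G) (take i ms).
Proof. by elim: G ms i => [|g G IH] [|b ms] [|i] //=; rewrite IH. Qed.

Lemma drop_resident G ms i : size ms = size G ->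
  drop i (resident G ms) = resident (drop i G) (drop i ms).
Proof. by elim: G ms i => [|g G IH] [|b ms] [|i] //= [h]; rewrite IH. Qed.

Lemma splice_resident G ms i j gs : size ms = size G -> i <= j <= size G ->
  splice (resident G ms) i j gs = resident (edited G i j gs) (replace ms i j (size gs)).
Proof.
move=> hm hij; rewrite /splice /edited /replace resident_cat ?size_takel; try lia.
rewrite resident_cat ?size_nseq // resident_true; congr (_ ++ _ ++ _).
  exact: take_resident.
exact: drop_resident.
Qed.

(** Only resident cells are edited, so the external list does not notice a step of the algorithm. *)
Lemma on_disk_replace G ms i j gs : size ms = size G -> i <= j <= size G ->
  (forall q, i <= q < j -> nth false ms q) ->
  on_disk (edited G i j gs) (replace ms i j (size gs)) = on_disk G ms.
Proof.
move=> hm hij hq.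
have e (T : Type) (s : seq T) : s = take i s ++ take (j - i) (drop i s) ++ drop j s.
  have -> : drop j s = drop (j - i) (drop i s) by rewrite drop_drop subnK //; lia.
  by rewrite !cat_take_drop.
have mask_true (k : nat) s : size s = k -> mask (map negb (nseq k true)) s = [::].
  by move=> <-; rewrite map_nseq /=; elim: s.
have et : take (j - i) (drop i ms) = nseq (j - i) true.
  apply: (@eq_from_nth _ false); rewrite ?size_nseq size_takel ?size_drop; try lia.
  by move=> q hqq; rewrite nth_take // nth_drop nth_nseq hqq hq; lia.
rewrite [in RHS](e _ G) [in RHS](e _ ms) et /on_disk /edited /replace !map_cat.
rewrite !mask_cat ?size_map ?size_nseq ?size_takel ?size_drop; try lia.
by rewrite !mask_true ?size_takel ?size_drop //; lia.
Qed.

Lemma cached_resident G ms : size ms = size G -> cached (resident G ms) = count id ms.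
Proof.
by elim: G ms => [|g G IH] [|b ms] //= [h]; rewrite /cached /= -/(cached _) IH //; case: b.
Qed.

Lemma isSome_resident G ms : size ms = size G -> map isSome (resident G ms) = ms.
Proof. by elim: G ms => [|g G IH] [|b ms] //= [h]; rewrite IH //; case: b. Qed.

Lemma agree_resident G ms cur : size ms = size G ->
  {in [:: 0; cur.-2; cur.-1; cur], forall i, i < size G -> nth false ms i} ->
  agree (resident G ms) G cur.
Proof.
move=> hm hn; split; first exact: size_resident.
move=> i /hn hi; rewrite /cell.
have [h|h] := ltnP i (size G); last first.
  by rewrite !nth_default ?size_resident ?size_map.
rewrite (nth_map (g0, false)) ?size_zip ?hm ?minnn // nth_zip //= hi //.
by rewrite (nth_map g0).
Qed.

(** * The caching policy *)

(** Cached head, hole, cached window around the cursor, tail on disk. Having four runs before and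
    after bounds a transfer by eight scans. *)
Definition window a m w r : bitseq :=
  expand [:: (a, true); (m, false); (w, true); (r, false)].

Lemma windowE a m w r :
  window a m w r = nseq a true ++ nseq m false ++ nseq w true ++ nseq r false.
Proof. by rewrite /window /expand /= cats0. Qed.

Lemma size_window a m w r : size (window a m w r) = a + m + w + r.
Proof. by rewrite windowE !size_cat !size_nseq; lia. Qed.

Lemma count_window a m w r : count id (window a m w r) = a + w.
Proof. by rewrite windowE !count_cat !count_nseq /=; lia. Qed.

Lemma nth_window a m w r i :
  nth false (window a m w r) i = (i < a) || (a + m <= i < a + m + w).
Proof. by rewrite windowE !nth_cat !size_nseq !nth_nseq; do !case: ifP; lia. Qed.

Lemma replace_cat P w Q i j k : i <= j <= w ->
  replace (P ++ nseq w true ++ Q) (size P + i) (size P + j) k =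
  P ++ nseq (i + k + (w - j)) true ++ Q.
Proof.
move=> hij; have -> : w = i + ((j - i) + (w - j)) by lia.
rewrite /replace; have -> : i + k + (i + (j - i + (w - j)) - j) = i + (k + (w - j)) by lia.
rewrite !nseqD -!catA.
have -> : P ++ nseq i true ++ nseq (j - i) true ++ nseq (w - j) true ++ Q =
    (P ++ nseq i true) ++ nseq (j - i) true ++ nseq (w - j) true ++ Q by rewrite !catA.
rewrite take_size_cat ?size_cat ?size_nseq // -!catA; congr (_ ++ (_ ++ (_ ++ _))).
rewrite !catA -catA drop_size_cat // !size_cat !size_nseq; lia.
Qed.

Lemma replace_front a m w r i j k : i <= j <= a ->
  replace (window a m w r) i j k = window (i + k + (a - j)) m w r.
Proof. by move=> h; rewrite !windowE; apply: (@replace_cat [::]). Qed.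

Lemma replace_back a m w r i j k : a + m <= i <= j -> j <= a + m + w ->
  replace (window a m w r) i j k = window a m ((i - (a + m)) + k + (a + m + w - j)) r.
Proof.
move=> h1 h2; rewrite !windowE !(catA (nseq a true)).
have hs : size (nseq a true ++ nseq m false) = a + m by rewrite size_cat !size_nseq.
have := @replace_cat (nseq a true ++ nseq m false) w (nseq r false)
  (i - (a + m)) (j - (a + m)) k.
rewrite hs !subnKC; try lia.
move=> ->; last lia.
by have -> : w - (j - (a + m)) = a + m + w - j by lia.
Qed.

(** Head and window are separated only when a hole remains between them, so [m = 0] can stand for
    one fused run. *)
Definition reloaded W s cur : bitseq :=
  if cur <= 2 * W then window 0 0 (minn s (cur + W)) (s - (cur + W))
  else window W (cur - 2 * W) (minn (s - (cur - W)) (2 * W)) (s - (cur + W)).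

Definition caching_policy W : policy := fun L cur =>
  let p := map isSome L in
  let s := size L in
  if all (fun i => (i < s) ==> nth false p i) [:: 0; cur.-2; cur.-1; cur] then p
  else reloaded W s cur.

(* [X] and [Y] are the potentials at the last reload.  The stable groups on disk ([r])
   start at least [W] cells right of the cursor of that time, the hole ([m]) ends
   [W] cells left of it, and [W - a] head groups have been deleted since. *)
Variant cache_shape W X Y x cur a m r : Prop :=
  CacheShape of
    r = 0 \/ r + 2 * X + W <= Y
  & Y <= m + r + X + 3 * W + 1
  & X <= m + 2 * W
  & m = 0 -> a = 0
  & 0 < m -> [/\ x + (W - a) <= X, a <= W, m + 2 * W <= X + 3 & a + m < cur].

(** Before the first reload no potentials have been recorded; [NothingCached] then only asks that a
    reload can be paid for. *)
Variant cache_ok B W X Y x psi cur s ms : Prop :=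
  | NothingCached of ms = window 0 s 0 0 & x + psi + B <= X + Y
  | Windows a m w r of ms = window a m w r & s = a + m + w + r & x <= X & psi <= Y
      & cache_shape W X Y x cur a m r.

Definition bounded s cur x psi :=
  [/\ 0 < cur <= s, cur <= x + 3, x <= cur, s + x <= psi & psi <= (s + x).+1].

Lemma cache_reload W s cur x psi : 1 < W -> bounded s cur x psi ->
  exists a m w r, [/\ reloaded W s cur = window a m w r, s = a + m + w + r,
    a + w <= 3 * W, cache_shape W x psi x cur a m r
    & {in [:: 0; cur.-2; cur.-1; cur], forall i, i < s -> nth false (reloaded W s cur) i}].
Proof.
move=> hW [h1 h2 h3 h4 h5]; rewrite /reloaded; case: leqP => h.
  exists 0, 0, (minn s (cur + W)), (s - (cur + W)); split=> //; try lia.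
    by split; lia.
  by move=> i; rewrite !inE nth_window => /or4P[] /eqP ->; lia.
exists W, (cur - 2 * W), (minn (s - (cur - W)) (2 * W)), (s - (cur + W)); split=> //; try lia.
  by split; try lia; move=> _; split; lia.
by move=> i; rewrite !inE nth_window => /or4P[] /eqP ->; lia.
Qed.

(** In a window state the cached cells number [s - m - r], at most [3 * W + 1 + (X - x)] by the
    potentials, and [X - x] is at most [2 * W + 2] since the cursor stays right of any hole. *)
Lemma cache_count B W X Y x psi cur s ms : 0 < W -> bounded s cur x psi ->
  cache_ok B W X Y x psi cur s ms -> count id ms <= 5 * W + 3.
Proof.
move=> hW [h1 h2 h3 h4 h5] [-> _|a m w r -> hs hx hp [s1 s2 s3 s4 s5]].
  by rewrite count_window.
rewrite count_window.
have [m0|m0] := posnP m; first by have := s4 m0; lia.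
by have [] := s5 m0; lia.
Qed.

(** A lost head cell means [W] deletions, each lowering [x]. A cursor reaching the hole means that
    [x] fell by at least [W - 4]; a cursor reaching the tail, that [psi] did. With [W = 5 * B] each
    drop is at least [B]. *)
Lemma cache_miss B X Y x psi cur s ms i : 0 < B -> bounded s cur x psi ->
  cache_ok B (5 * B) X Y x psi cur s ms ->
  i \in [:: 0; cur.-2; cur.-1; cur] -> i < s -> ~~ nth false ms i ->
  x + psi + B <= X + Y.
Proof.
move=> hB [h1 h2 h3 h4 h5] [-> //|a m w r -> hs hx hp [s1 s2 s3 s4 s5]].
rewrite nth_window !inE => hi his hn.
have {hi} hi : [\/ i = 0, i = cur.-2, i = cur.-1 | i = cur].
  by case/or4P: hi => /eqP; [constructor 1 | constructor 2 | constructor 3 | constructor 4].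
have [m0|m0] := posnP m.
  have a0 := s4 m0; subst m a.
  by case: hi => ?; case: s1; lia.
have [s6 s7 s8 s9] := s5 m0.
by case: hi => ?; case: s1; lia.
Qed.

(** Edits stay inside the cached parts, so [m] and [r] are constant between reloads and the shape
    carries over; a deleted head lowers [a] and [x] together. *)
Lemma cache_hit B W X Y x psi x' psi' cur cur' s ms i j gs :
  bounded s cur x psi -> cache_ok B W X Y x psi cur s ms ->
  {in [:: 0; cur.-2; cur.-1; cur], forall i, i < s -> nth false ms i} ->
  x' <= x -> psi' <= psi -> edit_range s cur cur' x x' i j gs ->
  cache_ok B W X Y x' psi' cur' (s + size gs - (j - i)) (replace ms i j (size gs)).
Proof.
move=> [h1 h2 h3 h4 h5] hc hn hx' hp' he.
have n0 := hn 0 (mem_head _ _); have n1 : cur.-2 < s -> nth false ms cur.-2.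
  by apply: hn; rewrite !inE eqxx orbT.
have n2 : cur.-1 < s -> nth false ms cur.-1 by apply: hn; rewrite !inE eqxx !orbT.
have n3 : cur < s -> nth false ms cur by apply: hn; rewrite !inE eqxx !orbT.
case: hc n0 n1 n2 n3 => [-> _|a m w r -> hs hx hp [s1 s2 s3 s4 s5]].
  by rewrite !nth_window; lia.
rewrite !nth_window => n0 n1 n2 n3.
have hr : r = 0 \/ cur < a + m + w.
  by have [m0|m0] := posnP m; [have := s4 m0; lia | have [] := s5 m0; lia].
have [m0|m0] := posnP m.
  have a0 := s4 m0; subst m a.
  have hw : 0 < w by move: n0; clear -h1 hs; lia.
  clear n0 n1 n2 n3 s5.
  have [hij hj] : i <= j /\ j <= w by case: he; clear -hs hr hw; lia.
  rewrite replace_back ?leq0n // !add0n.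
  apply: Windows; [reflexivity | clear -hs hij hj; lia | lia | lia |].
  by split=> //; lia.
have [s6 s7 s8 s9] := s5 m0.
have ha : 0 < a by move: n0; clear -h1 m0 hs; lia.
have hac : a + m + 2 <= cur by move: n1; clear -h1 s9 m0 hs; lia.
clear n0 n1 n2 n3 s5 h3 h4 h5 s9.
case: he => [ei hj hg ec|ei ej eg ec hx2|hi hj hjs hc].
- rewrite replace_front; last lia.
  apply: Windows; [reflexivity | lia | lia | lia |].
  have -> : i + size gs + (a - j) = a by lia.
  by split; [exact: s1 | exact: s2 | exact: s3 | lia | move=> _; split; lia].
- rewrite replace_front; last lia.
  apply: Windows; [reflexivity | rewrite eg /=; lia | lia | lia |].
  rewrite eg /=.
  by split; [exact: s1 | exact: s2 | exact: s3 | lia | move=> _; split; lia].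
rewrite replace_back; try lia.
apply: Windows; [reflexivity | lia | lia | lia |].
by split; [exact: s1 | exact: s2 | exact: s3 | lia | move=> _; split; lia].
Qed.

(** * Counting the I/Os *)

Lemma transfer_requests_same G ms p : transfer_requests (resident G ms) ms p = [::].
Proof. by elim: G ms p => [|g G IH] [|[] ms] p //=; apply: IH. Qed.

Lemma size_splice L (G : seq group) i j gs : size L = size G ->
  size (splice L i j gs) = size (edited G i j gs).
Proof. by move=> h; rewrite !size_cat !size_take !size_drop size_map h. Qed.

Lemma size_edited G i j gs : i <= j <= size G ->
  size (edited G i j gs) = size G + size gs - (j - i).
Proof. by move=> h; rewrite !size_cat size_takel ?size_drop; lia. Qed.

Lemma edit_range_bounds s cur cur' x x' i j gs : 0 < cur <= s ->
  edit_range s cur cur' x x' i j gs ->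
  i <= j <= s /\ {subset [pred q | i <= q < j] <= [:: 0; cur.-2; cur.-1; cur]}.
Proof.
move=> hcur he; split; first by case: he; lia.
by move=> q; rewrite !inE; case: he; lia.
Qed.

Section Cost.
Variables (c B : nat) (E : emlist group c B).
Hypothesis B_gt0 : 0 < B.

(** [W - 4 >= B] makes every miss cost [B] of potential; [N] covers the [5 * W + 3] cells that can
    be cached; 8 counts the runs of the old and the new window. *)
Let W := 5 * B.
Let N := 28 * B.
Let Q := 8 * (c * scan B (2 * N)).

(** [R] counts the reloads. The last clause is the amortized account: a reload raises [R] by one and
    replaces [X + Y] by a sum smaller by at least [B]. *)
Variant machine_inv (n base Z : nat) (m : machine E) (mu : nat) : Prop :=
  MachineInv G ms cur it ph out s i x psi X Y R of
      m = Machine (HHState (resident G ms) cur it ph out) s i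
    & size ms = size G & hh_inv n G cur it ph x psi mu
    & em_items s = on_disk G ms
    & cache_ok B W X Y x psi cur (size G) ms
    & i <= base + R * Q & R * B + (X + Y) <= Z.

Lemma cache_window X Y x psi cur s ms : cache_ok B W X Y x psi cur s ms ->
  exists a m w r, ms = window a m w r.
Proof. by case=> [-> _|a m w r -> *]; do 4!eexists; reflexivity. Qed.

Lemma machine_progress M n base Z m mu : 56 * B <= M -> machine_inv n base Z m mu ->
  exists2 m', machine_step 56 M (caching_policy W) n m = Some m' &
    (cells (algo m') = [::] /\ exists2 R, ios m' <= base + R * Q & R * B <= Z)
    \/ exists2 mu', mu' < mu & machine_inv n base Z m' mu'.
Proof.
move=> hM [G ms cur it ph out s i x psi X Y R -> hms hinv hs hc hi hR].
have hb : bounded (size G) cur x psi := inv_bounds hinv.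
set keep := caching_policy W (resident G ms) cur.
set rs := transfer_requests (resident G ms) keep 0.
have hWB : 5 * W + 3 <= N by rewrite /W /N; lia.
(* Either the cache is kept at no cost, or it is reloaded: then [R] grows by one and the current
   potentials become the reference. *)
have [X' [Y' [R' [hk hc' hn hcost hR']]]] : exists X' Y' R',
    [/\ size keep = size G, cache_ok B W X' Y' x psi cur (size G) keep,
      {in [:: 0; cur.-2; cur.-1; cur], forall q, q < size G -> nth false keep q},
      cost s rs <= (R' - R) * Q /\ R <= R' & R' * B + (X' + Y') <= Z].
  rewrite /rs /keep /caching_policy isSome_resident // size_resident //.
  case: ifP => [/allP hall|/negbT /allPn[q hq]].
    exists X, Y, R; split=> //.
      by move=> q /hall /implyP.
    by rewrite transfer_requests_same.
  rewrite negb_imply => /andP[hqs hqn].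
  have hW : 1 < W by rewrite /W; lia.
  have hmiss := cache_miss B_gt0 hb hc hq hqs hqn.
  have [a [w1 [w [r [e1 e2 e3 e4 e5]]]]] := cache_reload hW hb.
  have hsz : size (reloaded W (size G) cur) = size G by rewrite e1 size_window.
  exists x, psi, R.+1; split=> //; last by rewrite mulSn; lia.
    by apply: Windows e1 e2 _ _ e4.
  split; last by []; rewrite subSnn mul1n.
  have [a' [w1' [w' [r' e6]]]] := cache_window hc.
  have hW0 : 0 < W by lia.
  have hcount := cache_count hW0 hb hc.
  rewrite e1 in hsz *; rewrite e6 in hms hs hcount *.
  apply: (@cost_transfer c B E N 8 _ _ s G [::] [::]) => //; rewrite ?cats0 //.
    by apply: leq_trans hcount _.
  by rewrite -/(window a w1 w r) count_window; lia.
have [a [w1 [w [r ew]]]] := cache_window hc'.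
have hW0 : 0 < W by rewrite /W; lia.
have hcount1 := leq_trans (cache_count hW0 hb hc) hWB.
have hcount2 := leq_trans (cache_count hW0 hb hc') hWB.
have [hv hs'] := @items_transfer c B E s G ms keep [::] [::] hms hk
  (etrans hs (esym (cats0 _))).
rewrite cats0 -/rs in hs'.
have [p [q [gs [cur' [it' [ph' [hedit hnext]]]]]]] := inv_progress hinv.
have [out' hstep] := hedit _ out (agree_resident hk hn).
exists (Machine (HHState (splice (resident G keep) p q gs) cur' it' ph' out')
    (execute s rs) (i + cost s rs)).
  rewrite /machine_step -/keep -/rs.
  have -> : transfer_cells (resident G ms) keep (em_items s) = resident G keep.
    by rewrite hs -[on_disk _ _]cats0 transfer_cells_resident.
  rewrite !cached_resident // hstep.
  by have -> : (count id ms + count id keep <= 56 * B) && (count id ms + count id keep <= M);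
    first by rewrite /N in hcount1 hcount2; lia.
have hios : i + cost s rs <= base + R' * Q.
  have [h1 h2] := hcost; rewrite -(subnKC h2) mulnDl addnA.
  exact: leq_add.
case: hnext => [e0|[x' [psi' [mu' [hinv' hmu hx hp he]]]]].
  left; split.
    by apply: size0nil; rewrite /= (@size_splice _ G) ?size_resident // e0.
  by exists R' => //; lia.
right; exists mu' => //.
have [hb0 _ _ _ _] := hb.
have [hpq hsub] := edit_range_bounds hb0 he.
have hsz : size (replace keep p q (size gs)) = size (edited G p q gs).
  by rewrite !size_cat size_nseq !size_take !size_drop hk.
apply: (@MachineInv _ _ _ _ _ (edited G p q gs) (replace keep p q (size gs))
   _ _ _ _ _ _ x' psi' X' Y' R') hsz hinv' _ _ hios hR'.
- by rewrite splice_resident.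
- rewrite hs' on_disk_replace // => k hkk; apply: hn; first exact: hsub.
  by lia.
by rewrite size_edited //; apply: cache_hit hb hc' hn hx hp he.
Qed.

Lemma machine_terminates M n base Z m mu : 56 * B <= M -> machine_inv n base Z m mu ->
  exists t m', [/\ iter t (obind (machine_step 56 M (caching_policy W) n)) (Some m) = Some m',
    terminated m' & exists2 R, ios m' <= base + R * Q & R * B <= Z].
Proof.
move=> hM; elim/ltn_ind: mu m => mu IH m hm.
have [m' hstep [[hnil hR]|[mu' hmu hm']]] := machine_progress hM hm.
  by exists 1, m'; split; rewrite ?/terminated ?hnil.
have [t [m'' [h1 h2 h3]]] := IH _ hmu _ hm'.
by exists t.+1, m''; split=> //; rewrite iterSr /= hstep.
Qed.

End Cost.

Theorem lemma2 :
  exists K : nat, forall c : nat, exists C : nat,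
  forall M B : nat, 0 < B -> K * B <= M ->
  exists pol : policy,
  forall (E : emlist group c B) (D : seq nat),
    all (leq 1) D -> sorted leq D ->
    exists (t : nat) (m : machine E),
      [/\ run E K M pol D t = Some m,
          terminated m
        & ios m <= C * scan B (size (undup D))].
Proof.
(* [56 = 2 * 28], as the cells held before and after a transfer are counted together.
   [2241 = 1 + 5 * 8 * 56]: the initial write, and at most five reloads per block of the list, each
   of 8 scans of cost at most [56 * c]. *)
exists 56 => c; exists (c * 2241) => M B hB hM; exists (caching_policy (5 * B)) => E D _ hD.
have [D0|/eqP D0] := eqVneq D [::].
  by subst D; exists 0, (initial_machine E [::]).
have [x [psi [mu [hinv hx hpsi]]]] := inv_initial D0 hD.
set G := initial_groups D in hinv hx hpsi.
have hG : size G = size (undup D) by rewrite size_map.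
have := store_groups G (em_items_empty E).
set rs := map _ (zip _ G); move=> [hs hcost].
have hnone : resident G (nseq (size G) false) = nseq (size G) None.
  by elim: (G) => //= g G' <-.
have hdisk : on_disk G (nseq (size G) false) = G.
  by rewrite /on_disk map_nseq; elim: (G) => //= g G' {1}->.
(* The reference potentials at the start are a convention: their sum exceeds the current one by
   exactly [B], which pays for the first reload. *)
have hcache : cache_ok B (5 * B) (x + psi + B) 0 x psi (size G) (size G) (nseq (size G) false).
  by apply: NothingCached; rewrite ?windowE /= ?cats0 ?addn0.
have hinit : machine_inv (size D) (c * scan B (size G)) (x + psi + B) (initial_machine E D) mu.
  apply: (@MachineInv _ _ _ _ _ _ _ _ G (nseq (size G) false) (size G) 0 Extract [::]
    (execute (em_empty E) rs) (cost (em_empty E) rs) x psi (x + psi + B) 0 0 _ _ hinv _ hcache).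
  - by rewrite hnone.
  - by rewrite size_nseq.
  - by rewrite hs hdisk.
  - by rewrite addn0.
  - by rewrite addn0.
have [t [m [h1 h2 [R hR1 hR2]]]] := machine_terminates hB hM hinit.
exists t, m; split=> //; apply: leq_trans hR1 _; rewrite -hG.
have hscan : scan B (2 * (28 * B)) <= 56.
  by rewrite /scan -ltnS ltn_divLR //; lia.
have hSB : size G <= scan B (size G) * B.
  have := divn_eq (size G + B.-1) B; have := ltn_pmod (size G + B.-1) hB.
  by rewrite /scan; lia.
have [hb _ _ _ _] := inv_bounds hinv.
have hS : 0 < scan B (size G) by rewrite /scan divn_gt0 //; lia.
move: hscan hSB hS; set S := scan B (size G); set q := scan B _ => hscan hSB hS.
(* Here [x] is at most the length and [psi] at most twice the length plus one, so [x + psi + B] is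
   at most [3 + 1 + 1] multiples of [S * B]. *)
have hRS : R <= 5 * S.
  rewrite -(leq_pmul2r hB); apply: leq_trans hR2 _.
  have : B <= S * B by rewrite leq_pmull.
  lia.
have -> : c * 2241 * S = c * S + 5 * S * (8 * (c * 56)) by lia.
rewrite leq_add2l; apply: leq_mul => //.
by rewrite !leq_mul2l hscan !orbT.
Qed.
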